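(* Let $X\in\mathcal{B}_{\mathbf{l}}^{\boldsymbol\alpha}([0,1]^d,c(\cdot))$ be a locally stationary random field, and let $X_N=X_N(X,T_N)$ be its multivariate piecewise linear interpolator, where $T_N$ is a $cRS(h,\pi,\mathbf{l})$ sequence of designs with $h=(h_1,\ldots,h_k)$ and $\pi(N)=(n_1,\ldots,n_k)$. For $j=1,\ldots,k$ put $H_j(\mathbf{t}^j):=(1/h_j(t_{L_{j-1}+1}),\ldots,1/h_j(t_{L_j}))$ and $$v_j:=\int_{[0,1]^d} c_j(\mathbf{t})\,b_{\alpha_j,l_j}(H_j(\mathbf{t}^j))\,d\mathbf{t}.$$ Then $v_j>0$ for $j=1,\ldots,k$, and $$\|X-X_N\|_2^2\sim\sum_{j=1}^k\frac{v_j}{n_j^{\alpha_j}}>0\quad\text{as }N\to\infty,$$ where $\sim$ means that the ratio of the two sides tends to $1$.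
   Context: Random fields: $X=X(\mathbf{t})$, $\mathbf{t}\in[0,1]^d$, is a real-valued random field with $\mathrm{E}X(\mathbf{t})^2<\infty$ for all $\mathbf{t}$. For a random variable $\xi$ put $\|\xi\|:=(\mathrm{E}\xi^2)^{1/2}$; for vectors, $\|\cdot\|$ is the Euclidean norm. $\mathcal{C}([0,1]^d)$ is the space of quadratic mean (q.m.) continuous random fields, i.e. those for which $\mathbf{t}\mapsto X(\mathbf{t})\in L^2(\Omega)$ is continuous. For a field $Y$, $\|Y\|_2:=\left(\int_{[0,1]^d}\|Y(\mathbf{t})\|^2d\mathbf{t}\right)^{1/2}$. Decomposition: $k\le d$, $\mathbf{l}=(l_1,\ldots,l_k)$ is a vector of positive integers with $\sum_{j=1}^k l_j=d$, $L_0=0$, $L_i=\sum_{j=1}^i l_j$. For $\mathbf{s}\in\mathbb{R}^d$, $\mathbf{s}^j:=(s_{L_{j-1}+1},\ldots,s_{L_j})$, $j=1,\ldots,k$. $\boldsymbol\alpha=(\alpha_1,\ldots,\alpha_k)$ with $0<\alpha_j<2$. Local stationarity: $X\in\mathcal{B}_{\mathbf{l}}^{\boldsymbol\alpha}([0,1]^d,c(\cdot))$ means that $X\in\mathcal{C}([0,1]^d)$ and, for positive continuous functions $c_1,\ldots,c_k$ on $[0,1]^d$, $c=(c_1,\ldots,c_k)$, $$\frac{\|X(\mathbf{t}+\mathbf{s})-X(\mathbf{t})\|^2}{\sum_{j=1}^k c_j(\mathbf{t})\|\mathbf{s}^j\|^{\alpha_j}}\to1\quad\text{as }\mathbf{s}\to0\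 (\mathbf{s}\ne0,\ \mathbf{t}+\mathbf{s}\in[0,1]^d),\text{ uniformly in }\mathbf{t}\in[0,1]^d;$$ moreover each $c_j(\cdot)$ is invariant under permutations of the coordinates $t_{L_{j-1}+1},\ldots,t_{L_j}$ of the $j$-th component. Designs: $h_1,\ldots,h_k$ are positive continuous probability densities on $[0,1]$, not depending on $N$. $N$ ranges over an infinite set of positive integers, and for each such $N$, $\pi(N)=(n_1,\ldots,n_k)=(n_1(N),\ldots,n_k(N))$ is a vector of positive integers with $\prod_{j=1}^k(n_j+1)^{l_j}=N$ and $n_j(N)\to\infty$ as $N\to\infty$ for each $j$. For $i=L_{j-1}+1,\ldots,L_j$ put $h_i^*:=h_j$, $n_i^*:=n_j$. The design $T_N$ is $cRS(h,\pi,\mathbf{l})$ (cross regular sequence) if $T_N=\{\mathbf{t}_{\mathbf{i}}=(t_{1,i_1},\ldots,t_{d,i_d}):0\le i_m\le n_m^*,\ m=1,\ldots,d\}$, where $\int_0^{t_{m,i}}h_m^*(v)\,dv=i/n_m^*$, $i=0,\ldots,n_m^*$. Interpolator: let $*$ denote coordinatewise multiplication. For $\mathbf{i}$ with $0\le i_m\le n_m^*-1$ let $\mathbf{r}_{\mathbf{i}}=\mathbf{t}_{\mathbf{i}+(1,\ldots,1)}-\mathbf{t}_{\mathbf{i}}$ and $\mathcal{D}_{\mathbf{i}}=\{\mathbf{t}_{\mathbf{i}}+\mathbf{r}_{\mathbf{i}}*\mathbf{s}:\mathbf{s}\in[0,1]^d\}$. The multivariate piecewise linear interpolator (MPLI)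 is $$X_N(\mathbf{t}):=\mathrm{E}_{\boldsymbol\eta}X(\mathbf{t}_{\mathbf{i}}+\mathbf{r}_{\mathbf{i}}*\boldsymbol\eta),\quad \mathbf{t}=\mathbf{t}_{\mathbf{i}}+\mathbf{r}_{\mathbf{i}}*\mathbf{s}\in\mathcal{D}_{\mathbf{i}},$$ where $\boldsymbol\eta=(\eta_1,\ldots,\eta_d)$ has independent Bernoulli components with means $s_1,\ldots,s_d$, auxiliary to (independent of) $X$, and $\mathrm{E}_{\boldsymbol\eta}$ is expectation over $\boldsymbol\eta$ only; i.e. $X_N(\mathbf{t})=\sum_{\mathbf{e}\in\{0,1\}^d}X(\mathbf{t}_{\mathbf{i}}+\mathbf{r}_{\mathbf{i}}*\mathbf{e})\prod_{m=1}^d s_m^{e_m}(1-s_m)^{1-e_m}$. The constant $b_{\beta,m}$: for $0<\beta<2$ and $m\in\mathbb{N}$, $B_{\beta,m}(\mathbf{t})$, $\mathbf{t}\in\mathbb{R}_+^m$, is the (zero mean) fractional Brownian field with covariance $r(\mathbf{t},\mathbf{s})=\frac12(\|\mathbf{t}\|^\beta+\|\mathbf{s}\|^\beta-\|\mathbf{t}-\mathbf{s}\|^\beta)$. For $\mathbf{u}\in\mathbb{R}_+^m$ (positive coordinates), $$b_{\beta,m}(\mathbf{u}):=\int_{[0,1]^m}\left\|B_{\beta,m}(\mathbf{u}*\mathbf{s})-\mathrm{E}_{\boldsymbol\eta}B_{\beta,m}(\mathbf{u}*\boldsymbol\eta)\right\|^2d\mathbf{s},$$ where $\boldsymbol\eta=(\eta_1,\ldots,\eta_m)$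 has independent Bernoulli components with means $s_1,\ldots,s_m$, and $\mathrm{E}_{\boldsymbol\eta}$ is expectation over $\boldsymbol\eta$ only. *)

(* Defs.v *)
From HB Require Import structures.
From mathcomp Require Export all_boot all_order all_algebra all_fingroup.
From mathcomp Require Export all_classical all_reals all_analysis.

Set Implicit Arguments.
Unset Strict Implicit.
Unset Printing Implicit Defensive.

Export Order.TTheory GRing.Theory Num.Theory.
Export numFieldNormedType.Exports.

Global Open Scope classical_set_scope.
Global Open Scope ring_scope.

Section cons_measure.
Local Open Scope ereal_scope.
Context d (T : measurableType d) (R : realType) (n : nat).
Variables (m1 : {sigma_finite_measure set T -> \bar R})
          (m2 : {sigma_finite_measure set (n.-tuple T) -> \bar R}).

Definition tcons (p : T * n.-tuple T) : n.+1.-tuple T := [tuple of p.1 :: p.2].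

Lemma measurable_tcons : measurable_fun [set: T * n.-tuple T] tcons.
Proof. exact: measurable_cons. Qed.

Definition cons_measure : set (n.+1.-tuple T) -> \bar R :=
  pushforward (m1 \x m2) tcons.

Let cm0 : cons_measure set0 = 0.
Proof. by rewrite /cons_measure /pushforward preimage_set0 measure0. Qed.

Let mtcons A : measurable A -> measurable (tcons @^-1` A).
Proof. by move=> mA; rewrite -[X in measurable X]setTI; exact: measurable_tcons. Qed.

Let cm_ge0 A : 0 <= cons_measure A.
Proof. by rewrite /cons_measure /pushforward; exact: measure_ge0. Qed.

Let cm_sigma_additive : semi_sigma_additive cons_measure.
Proof.
move=> F mF tF mUF; rewrite /cons_measure /pushforward preimage_bigcup.
apply: measure_semi_sigma_additive.
- by move=> i; exact: mtcons.
- apply/trivIsetP => /= i j _ _ ij; rewrite -preimage_setI.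
  by move/trivIsetP : tF => /(_ _ _ _ _ ij) ->//; rewrite preimage_set0.
- by rewrite -preimage_bigcup; exact: mtcons.
Qed.

HB.instance Definition _ := isMeasure.Build _ _ _ cons_measure
  cm0 cm_ge0 cm_sigma_additive.

Let cm_sigma_finite : sigma_finite setT cons_measure.
Proof.
have /sigma_finiteP[F [TF ndF Foo]] := sigma_finiteT m1.
have /sigma_finiteP[G [TG ndG Goo]] := sigma_finiteT m2.
pose bh (x : n.+1.-tuple T) : n.-tuple T := [tuple of behead x].
pose hd (x : n.+1.-tuple T) : T := tnth x ord0.
have bhK p : bh (tcons p) = p.2 by apply/val_inj.
have hdK p : hd (tcons p) = p.1 by [].
exists (fun i => (hd @^-1` F i) `&` (bh @^-1` G i)).
  apply/esym; rewrite -subTset => x _.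
  have [i _ Fi] : (\bigcup_i F i) (hd x) by rewrite -TF.
  have [j _ Gj] : (\bigcup_i G i) (bh x) by rewrite -TG.
  exists (maxn i j) => //; split => /=.
    by move: (hd x) Fi; apply/subsetPset/ndF/leq_maxl.
  by move: (bh x) Gj; apply/subsetPset/ndG/leq_maxr.
move=> i; have [mF Fi] := Foo i; have [mG Gi] := Goo i; split.
  apply: measurableI; rewrite -[X in measurable X]setTI.
    exact: (measurable_tnth ord0).
  exact: measurable_behead.
rewrite /cons_measure /pushforward (_ : _ @^-1` _ = F i `*` G i).
  by rewrite product_measure1E// lte_mul_pinfty// ge0_fin_numE.
by apply/seteqP; split => p; rewrite /preimage/= bhK hdK.
Qed.

HB.instance Definition _ := Measure_isSigmaFinite.Build _ _ _ cons_measure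
  cm_sigma_finite.

End cons_measure.

(* Lebesgue measure on R^n.  It lives on tuples, the n-fold product that the
   library equips with a sigma-algebra; [measurableTypeR R] is R with its Borel
   sets, the carrier of [lebesgue_measure]. *)
Fixpoint lebesgue_tuple (R : realType) (n : nat) :
    {sigma_finite_measure set (n.-tuple (measurableTypeR R)) -> \bar R} :=
  match n with
  | 0 => \d_([tuple] : 0.-tuple (measurableTypeR R))
  | n.+1 => cons_measure (@lebesgue_measure R) (lebesgue_tuple R n)
  end.

Lemma lebesgue_tuple_box (R : realType) (n : nat)
    (A : 'I_n -> set (measurableTypeR R)) :
  (forall i, measurable (A i)) ->
  lebesgue_tuple R n [set x | forall i, A i (tnth x i)] =
  (\prod_(i < n) lebesgue_measure (A i))%E.
Proof.
elim: n A => [|n IHn] A mA.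
  by rewrite big_ord0 /= diracE mem_set// => -[].
rewrite big_ord_recl -IHn//= /cons_measure /pushforward.
rewrite (_ : _ @^-1` _ = A ord0 `*` [set x | forall i, A (lift ord0 i) (tnth x i)]).
  rewrite product_measure1E//.
  rewrite (_ : mkset _ = \bigcap_i ((@tnth n _ ^~ i) @^-1` A (lift ord0 i))).
    apply: fin_bigcap_measurable => // i _.
    by rewrite -[X in measurable X]setTI; exact: measurable_tnth.
  by apply/seteqP; split => x /= h i; [move=> _|]; exact: h.
apply/seteqP; split => [[a x]/= h|[a x]/= [h0 h] i].
  by split=> [|i]; [have := h ord0|have := h (lift ord0 i); rewrite tnthS].
by case: (unliftP ord0 i) => [j ->|->]//; rewrite tnthS; exact: h.
Qed.

Section cube.
Context {R : realType}.
Implicit Types n : nat.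

Definition unit_cube n : set 'rV[R]_n := [set t | forall i, 0 <= t 0 i <= 1].
Arguments unit_cube n : clear implicits.

Definition row_of_tuple n (x : n.-tuple (measurableTypeR R)) : 'rV[R]_n :=
  \row_i tnth x i.

Definition cube_integral n (f : 'rV[R]_n -> R) : R :=
  \int[lebesgue_tuple R n]_(x in @row_of_tuple n @^-1` unit_cube n)
    f (row_of_tuple x).

(* The library norm on matrices is the max norm. *)
Definition euclid_norm n (s : 'rV[R]_n) : R := Num.sqrt (\sum_i s 0 i ^+ 2).

Definition cmul n (u v : 'rV[R]_n) : 'rV[R]_n := map2_mx *%R u v.

(* E f(eta) for eta with independent Bernoulli components of means s_i. *)
Definition bernoulli_mean n (s : 'rV[R]_n) (f : 'rV[R]_n -> R) : R :=
  \sum_(e : {ffun 'I_n -> bool})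
    f (\row_i (e i)%:R) *
    \prod_i (s 0 i ^+ e i * (1 - s 0 i) ^+ (~~ e i)).

End cube.
Arguments unit_cube {R} n.

Section random_fields.
Context {R : realType} d {Omega : measurableType d} (P : probability Omega R).

Definition L2norm (xi : Omega -> R) : R := Num.sqrt (fine 'E_P[xi ^+ 2]%E).

Definition field_norm n (Y : 'rV[R]_n -> Omega -> R) : R :=
  Num.sqrt (cube_integral (fun t => L2norm (Y t) ^+ 2)).

Definition qm_continuous n (X : 'rV[R]_n -> {RV P >-> R}) : Prop :=
  (forall t, unit_cube n t -> ('E_P[(X t : Omega -> R) ^+ 2] < +oo)%E) /\
  (forall t, unit_cube n t ->
     (fun s => L2norm (X s \- X t)) @ within (unit_cube n) (nbhs t) --> (0 : R)).

(* Degenerate (a.s. constant) variables count as Gaussian; [normal_prob a 0]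
   is not a point mass in the library, whence the separate clause. *)
Definition gaussian (Y : Omega -> R) : Prop :=
  (exists a : R, forall A : set R, measurable A -> P (Y @^-1` A) = \d_a A) \/
  (exists a s : R, s != 0 /\
     forall A : set R, measurable A -> P (Y @^-1` A) = normal_prob a s A).

End random_fields.

Definition orthant (R : realType) m : set 'rV[R]_m :=
  [set t | forall i, 0 <= t 0 i].

(* Any realization of the fractional Brownian field on R_+^m; values at points
   outside the orthant are unconstrained. *)
Record fractional_brownian_field (R : realType) (beta : R) (m : nat) := FBF {
  fbf_display : measure_display;
  fbf_space : measurableType fbf_display;
  fbf_prob : probability fbf_space R;
  fbf_field :> 'rV[R]_m -> {RV fbf_prob >-> R};
  fbf_gaussian : forall (p : nat) (a : 'I_p -> R) (t : 'I_p -> 'rV[R]_m),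
    (forall i, orthant (t i)) ->
    gaussian fbf_prob (fun w => \sum_i a i * fbf_field (t i) w);
  fbf_mean : forall t, orthant t -> ('E_fbf_prob[fbf_field t] = 0)%E;
  fbf_covariance : forall t s, orthant t -> orthant s ->
    covariance fbf_prob (fbf_field t) (fbf_field s) =
    (2^-1 * (euclid_norm t `^ beta + euclid_norm s `^ beta
             - euclid_norm (t - s) `^ beta))%:E
}.

Definition b_const (R : realType) (beta : R) (m : nat)
    (B : fractional_brownian_field beta m) (u : 'rV[R]_m) : R :=
  cube_integral (fun s =>
    L2norm (fbf_prob B) (fun w =>
      B (cmul u s) w - bernoulli_mean s (fun eta => B (cmul u eta) w)) ^+ 2).

(* A point of R^d, d = \sum_j l j, is a row vector cut into k consecutive
   blocks of lengths l j: [submxrow s j] is the block s^j, and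
   [tagnat.sig1 m : 'I_k] is the block containing the coordinate m. *)
Section decomposition.
Context {R : realType} {k : nat} (l : 'I_k -> nat).
Local Notation d := (\sum_(j < k) l j)%N.

Definition locally_stationary disp (Omega : measurableType disp)
    (P : probability Omega R) (alpha : 'I_k -> R) (c : 'I_k -> 'rV[R]_d -> R)
    (X : 'rV[R]_d -> {RV P >-> R}) : Prop :=
  [/\ qm_continuous X,
      forall j, {within unit_cube d, continuous (c j)} /\
        (forall t, unit_cube d t -> 0 < c j t),
      forall eps : R, 0 < eps -> exists2 delta : R, 0 < delta &
        forall t s, unit_cube d t -> s != 0 -> unit_cube d (t + s) ->
          euclid_norm s < delta ->
          `| L2norm P (X (t + s) \- X t) ^+ 2 /
             (\sum_j c j t * euclid_norm (submxrow s j) `^ alpha j) - 1 | < eps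
    & forall j (sigma : 'S_(l j)) t t', unit_cube d t -> unit_cube d t' ->
        submxrow t' j = col_perm sigma (submxrow t j) ->
        (forall i, i != j -> submxrow t' i = submxrow t i) ->
        c j t' = c j t].

Definition design_density (h : R -> R) : Prop :=
  [/\ {within `[0, 1], continuous h},
      forall x, 0 <= x <= 1 -> 0 < h x
    & \int[lebesgue_measure]_(x in `[0, 1]) h x = 1].

(* NN is the set over which N ranges, n N j is n_j(N). *)
Definition design_sizes (NN : set nat) (n : nat -> 'I_k -> nat) : Prop :=
  [/\ infinite_set NN,
      forall N, NN N -> forall j, (0 < n N j)%N,
      forall N, NN N -> (\prod_j (n N j).+1 ^ l j)%N = N
    & forall j, (n ^~ j) @ within NN \oo --> \oo].

(* For one N: knot m i is t_{m,i}. *)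
Definition cross_regular (h : 'I_k -> R -> R) (n : 'I_k -> nat)
    (knot : 'I_d -> nat -> R) : Prop :=
  forall (m : 'I_d) (i : nat), (i <= n (tagnat.sig1 m))%N ->
    0 <= knot m i <= 1 /\
    \int[lebesgue_measure]_(v in `[0, knot m i]) h (tagnat.sig1 m) v =
      i%:R / (n (tagnat.sig1 m))%:R.

Definition grid_point (knot : 'I_d -> nat -> R) (i : 'I_d -> nat) : 'rV[R]_d :=
  \row_m knot m (i m).

(* Neighbouring cells give the same value on their common faces, so this
   determines XN on the unit cube. *)
Definition is_mpli (Omega : Type) (n : 'I_k -> nat) (knot : 'I_d -> nat -> R)
    (X XN : 'rV[R]_d -> Omega -> R) : Prop :=
  forall i : 'I_d -> nat, (forall m, i m < n (tagnat.sig1 m))%N ->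
    let t_i := grid_point knot i in
    let r_i := grid_point knot (fun m => (i m).+1) - t_i in
    forall s, unit_cube d s -> forall w,
      XN (t_i + cmul r_i s) w =
      bernoulli_mean s (fun eta => X (t_i + cmul r_i eta) w).

Definition inv_density (h : 'I_k -> R -> R) (j : 'I_k) (u : 'rV[R]_(l j)) :
    'rV[R]_(l j) := \row_i (h j (u 0 i))^-1.

Definition v_const (alpha : 'I_k -> R)
    (B : forall j, fractional_brownian_field (alpha j) (l j))
    (c : 'I_k -> 'rV[R]_d -> R) (h : 'I_k -> R -> R) (j : 'I_k) : R :=
  cube_integral (fun t => c j t * b_const (B j) (inv_density h (submxrow t j))).

End decomposition.

(* Main.v *)
Require Import Defs.
From mathcomp Require Import measurable_realfun ring lra.

Set Implicit Arguments.
Unset Strict Implicit.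
Unset Printing Implicit Defensive.

(** Write [X s - X_N s] on one cell as the error of a multilinear interpolation
    with weights that sum to 1.  Its mean square is then a linear functional
    [interp_error] of the mean squares [g x y = E (X x - X y) ^ 2] of the
    increments of the field (an identity between quadratic polynomials, see
    [sqr_interpolation_error] and [L2norm_interpolation]).  Local stationarity
    says that on a small cell [g x y] is, up to a relative error that vanishes
    uniformly, [\sum_j c_j(t) |x^j - y^j| ^ alpha_j], with the coefficients
    frozen at the corner [t] of the cell ([field_increment_estimate]).  As the
    functional is linear and does not increase sup norms by more than a factor
    3/2, it may be evaluated on this sum instead.  There the blocks separate,
    because averaging over the coordinates outside a block does nothing, and
    what is left for the block [j] is [c_j(t)] times the same functional for a
    fractional Brownian field, which is the integrand of [b_{alpha_j, l_j}].

    The knots satisfy [n_j * (t_{i+1} - t_i) ~ 1 / h_j] by the mean value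
    theorem ([knot_step_dist]) and [|.| ^ alpha_j] is homogeneous, so this term
    is [n_j ^ - alpha_j] times the integrand of [b] at [H_j(t)]
    ([cell_estimate]).  Integrating over the cell replaces it by
    [c_j(t) b(H_j(t))], and since the cells are affine images of the unit cube
    with total volume 1 ([cube_integral_subdivision]), summing over the cells
    gives [\sum_j v_j n_j ^ - alpha_j] up to a small multiple of
    [\sum_j n_j ^ - alpha_j] ([mpli_error_estimate]).

    That error is negligible because [v_j > 0]: the integrand of [v_j] is
    continuous, and [b] is positive since at the midpoint of an edge of the cube
    the interpolation error of a fractional Brownian field is proportional to
    [2 ^ - alpha - 1 / 4], which is positive for [alpha < 2]
    ([fbf_interp_error_gt0], [cube_integral_gt0]). *)

Local Notation cube := (unit_cube _).

(** * Multilinear interpolation *)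

Section bernoulli_mean_theory.
Context {R : realType}.

Let weight n (s : 'rV[R]_n) (e : {ffun 'I_n -> bool}) : R :=
  \prod_i (s 0 i ^+ e i * (1 - s 0 i) ^+ (~~ e i)).

Lemma vertex_cube n (e : {ffun 'I_n -> bool}) :
  cube (\row_i (e i)%:R : 'rV[R]_n).
Proof. by move=> i; rewrite mxE; case: (e i) => /=; rewrite ?lexx ler01. Qed.

Let weight_ge0 n (s : 'rV[R]_n) e : cube s -> 0 <= weight s e.
Proof.
move=> cs; apply: prodr_ge0 => i _; have /andP[s0 s1] := cs i.
by rewrite mulr_ge0// exprn_ge0// subr_ge0.
Qed.

Let weight_sum n (s : 'rV[R]_n) : \sum_e weight s e = 1.
Proof.
rewrite /weight.
rewrite -(bigA_distr_bigA
  (fun i b => s 0 i ^+ nat_of_bool b * (1 - s 0 i) ^+ (~~ b))).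
by apply: big1 => i _; rewrite big_bool/= !expr1 !expr0 mul1r mulr1 addrC subrK.
Qed.

Lemma eq_bernoulli_mean n (s : 'rV[R]_n) (f g : 'rV[R]_n -> R) :
  (forall x, cube x -> f x = g x) -> bernoulli_mean s f = bernoulli_mean s g.
Proof.
by move=> fg; apply: eq_bigr => e _; rewrite fg//; exact: vertex_cube.
Qed.

Lemma bernoulli_mean_cst n (s : 'rV[R]_n) (a : R) :
  bernoulli_mean s (fun=> a) = a.
Proof. by rewrite /bernoulli_mean -mulr_sumr weight_sum mulr1. Qed.

Lemma bernoulli_meanZ n (s : 'rV[R]_n) a (f : 'rV[R]_n -> R) :
  bernoulli_mean s (fun x => a * f x) = a * bernoulli_mean s f.
Proof. by rewrite mulr_sumr; apply: eq_bigr => e _; rewrite mulrA. Qed.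

Lemma bernoulli_mean_sum n (s : 'rV[R]_n) (I : Type) (r : seq I)
    (f : I -> 'rV[R]_n -> R) :
  bernoulli_mean s (fun x => \sum_(i <- r) f i x) =
  \sum_(i <- r) bernoulli_mean s (f i).
Proof. by rewrite exchange_big; apply: eq_bigr => e _; rewrite mulr_suml. Qed.

Lemma bernoulli_meanD n (s : 'rV[R]_n) (f g : 'rV[R]_n -> R) :
  bernoulli_mean s (fun x => f x + g x) =
  bernoulli_mean s f + bernoulli_mean s g.
Proof. by rewrite -big_split; apply: eq_bigr => e _; rewrite mulrDl. Qed.

Lemma bernoulli_meanB n (s : 'rV[R]_n) (f g : 'rV[R]_n -> R) :
  bernoulli_mean s (fun x => f x - g x) =
  bernoulli_mean s f - bernoulli_mean s g.
Proof. by rewrite -sumrB; apply: eq_bigr => e _; rewrite mulrBl. Qed.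

Lemma bernoulli_mean_dist n (s : 'rV[R]_n) (f g : 'rV[R]_n -> R) delta :
  cube s -> (forall x, cube x -> `|f x - g x| <= delta) ->
  `|bernoulli_mean s f - bernoulli_mean s g| <= delta.
Proof.
move=> cs fg; rewrite -bernoulli_meanB.
apply: le_trans (ler_norm_sum _ _ _) _.
rewrite -[leRHS](bernoulli_mean_cst s); apply: ler_sum => e _.
rewrite normrM (ger0_norm (weight_ge0 e cs)) ler_wpM2r ?weight_ge0//.
by apply: fg; exact: vertex_cube.
Qed.

(** Only the coordinates that the integrand reads matter: the weights of each
    of the others sum to 1. *)
Lemma bernoulli_mean_colsub m n (sigma : 'I_m -> 'I_n) (s : 'rV[R]_n)
    (f : 'rV[R]_m -> R) : injective sigma ->
  bernoulli_mean s (fun x => f (colsub sigma x)) =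
  bernoulli_mean (colsub sigma s) f.
Proof.
move=> injs; rewrite /bernoulli_mean.
pose restr (e : {ffun 'I_n -> bool}) := [ffun a => e (sigma a)].
rewrite (partition_big restr xpredT)//=; apply: eq_bigr => e' _.
under eq_bigr => e /eqP ee'.
  rewrite (_ : colsub sigma _ = \row_i (e' i)%:R); last first.
    by apply/rowP => a; rewrite !mxE -ee' ffunE.
  over.
rewrite -mulr_sumr; congr (_ * _).
pose Q (i : 'I_n) : pred bool :=
  fun b => [forall a, (sigma a == i) ==> (b == e' a)].
rewrite (eq_bigl (fun e => e \in family Q)); last first.
  move=> e; apply/eqP/familyP => [ee' i|eQ].
    rewrite unfold_in; apply/forallP => a; apply/implyP => /eqP <-.
    by rewrite -ee' ffunE.
  apply/ffunP => a; rewrite ffunE; have := eQ (sigma a).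
  by rewrite unfold_in => /forallP/(_ a); rewrite eqxx => /eqP.
rewrite -(bigA_distr_big_dep Q
  (fun i b => s 0 i ^+ nat_of_bool b * (1 - s 0 i) ^+ (~~ b))).
rewrite (bigID (mem (codom sigma)))/= [X in _ * X]big1 ?mulr1; last first.
  move=> i iN; rewrite (eq_bigl xpredT); last first.
    move=> b; apply/forallP => a; apply/implyP => /eqP ai.
    by move: iN; rewrite -ai codom_f.
  by rewrite big_bool/= !expr1 !expr0 mul1r mulr1 addrC subrK.
rewrite (eq_bigl (fun i => i \in sigma @: 'I_m)); last first.
  move=> i; apply/idP/idP => [/codomP[a ->]|/imsetP[a _ ->]].
    exact: imset_f.
  exact: codom_f.
rewrite big_imset/=; last by move=> a b _ _; exact: injs.
apply: eq_bigr => a _.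
rewrite (eq_bigl (pred1 (e' a))) ?big_pred1_eq ?mxE//.
move=> b; apply/forallP/eqP => [/(_ a)|-> a'].
  by rewrite eqxx => /eqP.
by apply/implyP => /eqP/injs ->.
Qed.

(** If [g x y = E (Y x - Y y) ^ 2] then this is the mean square error of
    replacing [Y s] by the multilinear interpolant of its values at the
    vertices of the unit cube, see [sqr_interpolation_error].  Unlike that
    error, it is linear in [g]. *)
Definition interp_error n (g : 'rV[R]_n -> 'rV[R]_n -> R) (s : 'rV[R]_n) : R :=
  bernoulli_mean s (g s)
  - 2^-1 * bernoulli_mean s (fun x => bernoulli_mean s (g x)).

Lemma sqr_interpolation_error n (y : 'rV[R]_n -> R) (s : 'rV[R]_n) :
  (y s - bernoulli_mean s y) ^+ 2 =
  interp_error (fun a b => (y a - y b) ^+ 2) s.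
Proof.
have sqrE a : bernoulli_mean s (fun b => (y a - y b) ^+ 2) =
    y a ^+ 2 - 2 * y a * bernoulli_mean s y + bernoulli_mean s (fun b => y b ^+ 2).
  transitivity (bernoulli_mean s
      (fun b => y a ^+ 2 - 2 * y a * y b + y b ^+ 2)).
    by apply: eq_bernoulli_mean => b _; ring.
  by rewrite bernoulli_meanD bernoulli_meanB bernoulli_mean_cst bernoulli_meanZ.
rewrite /interp_error sqrE.
rewrite (@eq_bernoulli_mean _ s (fun a => bernoulli_mean s _)
    (fun a => y a ^+ 2 - 2 * bernoulli_mean s y * y a
              + bernoulli_mean s (fun b => y b ^+ 2))); last first.
  by move=> a _; rewrite sqrE; ring.
rewrite bernoulli_meanD bernoulli_meanB bernoulli_mean_cst bernoulli_meanZ.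
by field.
Qed.

Lemma eq_interp_error n (g g' : 'rV[R]_n -> 'rV[R]_n -> R) s : cube s ->
  (forall x y, cube x -> cube y -> g x y = g' x y) ->
  interp_error g s = interp_error g' s.
Proof.
move=> cs gg'; rewrite /interp_error; congr (_ - _ * _).
  by apply: eq_bernoulli_mean => x cx; exact: gg'.
by apply: eq_bernoulli_mean => x cx; apply: eq_bernoulli_mean => y cy; exact: gg'.
Qed.

Lemma interp_error_dist n (g g' : 'rV[R]_n -> 'rV[R]_n -> R) s delta :
  cube s ->
  (forall x y, cube x -> cube y -> `|g x y - g' x y| <= delta) ->
  `|interp_error g s - interp_error g' s| <= 3 / 2 * delta.
Proof.
move=> cs gg'; rewrite /interp_error.
have h1 := bernoulli_mean_dist cs (fun x cx => gg' s x cs cx).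
have h2 : `|bernoulli_mean s (fun x => bernoulli_mean s (g x))
   - bernoulli_mean s (fun x => bernoulli_mean s (g' x))| <= delta.
  apply: bernoulli_mean_dist => // x cx.
  by apply: bernoulli_mean_dist => // y cy; exact: gg'.
move: h1 h2; rewrite !ler_norml; lra.
Qed.

Lemma interp_errorZ n (g : 'rV[R]_n -> 'rV[R]_n -> R) a s :
  interp_error (fun x y => a * g x y) s = a * interp_error g s.
Proof.
rewrite /interp_error bernoulli_meanZ.
under [X in _ - _ * X]eq_bernoulli_mean do rewrite bernoulli_meanZ.
by rewrite bernoulli_meanZ mulrBr mulrCA.
Qed.

Lemma interp_error_sum n (I : Type) (r : seq I)
    (g : I -> 'rV[R]_n -> 'rV[R]_n -> R) s :
  interp_error (fun x y => \sum_(i <- r) g i x y) s =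
  \sum_(i <- r) interp_error (g i) s.
Proof.
rewrite /interp_error bernoulli_mean_sum.
under [X in _ - _ * X]eq_bernoulli_mean do rewrite bernoulli_mean_sum.
by rewrite bernoulli_mean_sum mulr_sumr -sumrB.
Qed.

Lemma interp_error_colsub m n (sigma : 'I_m -> 'I_n)
    (g : 'rV[R]_m -> 'rV[R]_m -> R) (s : 'rV[R]_n) : injective sigma ->
  interp_error (fun x y => g (colsub sigma x) (colsub sigma y)) s =
  interp_error g (colsub sigma s).
Proof.
move=> injs; rewrite /interp_error bernoulli_mean_colsub//.
under [X in _ - _ * X]eq_bernoulli_mean do rewrite bernoulli_mean_colsub//.
by rewrite (bernoulli_mean_colsub _ (fun x => bernoulli_mean _ (g x))).
Qed.

End bernoulli_mean_theory.

(** * Lebesgue measure on the cube and its images *)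

(** The rectangles are stable under intersection and generate the product
    sigma-algebra, so that finite measures are determined by them. *)
Lemma tuple_measure_unique (R : realType) n
    (m1 m2 : {measure set (n.-tuple (measurableTypeR R)) -> \bar R}) :
  (m1 setT < +oo)%E ->
  (forall A : 'I_n -> set (measurableTypeR R), (forall i, measurable (A i)) ->
    m1 [set x | forall i, A i (tnth x i)] =
    m2 [set x | forall i, A i (tnth x i)]) ->
  forall E, measurable E -> m1 E = m2 E.
Proof.
move=> m1fin m12.
pose rect (A : 'I_n -> set (measurableTypeR R)) :=
  [set x : n.-tuple (measurableTypeR R) | forall i, A i (tnth x i)].
pose G := [set rect A | A in [set A | forall i, measurable (A i)]].
have GT : G setT.
  by exists (fun=> setT) => //; apply/seteqP; split.
have mrect A : (forall i, measurable (A i)) -> measurable (rect A).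
  move=> mA; rewrite (_ : rect A =
      \bigcap_i ((@tnth n (measurableTypeR R) ^~ i) @^-1` A i)).
    apply: fin_bigcap_measurable => // i _.
    by rewrite -[X in measurable X]setTI; exact: measurable_tnth.
  by apply/seteqP; split => x /= h i; [move=> _|]; exact: h.
apply: (measure_unique G (fun=> setT)) => //.
- apply/seteqP; split; last first.
    apply: smallest_sub => //; first exact: sigma_algebra_measurable.
    by move=> _ [A mA <-]; exact: mrect.
  have : measurable_fun [set: g_sigma_algebraType G]
      (id : g_sigma_algebraType G -> n.-tuple (measurableTypeR R)).
    apply/measurable_fun_tnthP => i _ A mA; rewrite setTI.
    apply: sub_sigma_algebra.
    exists (fun j => if j == i then A else setT).
      by move=> j; case: ifP.
    apply/seteqP; split => x /=; first by move/(_ i); rewrite eqxx.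
    by move=> Ax j; case: eqP => // ->.
  by move=> mid E mE; have := mid measurableT E mE; rewrite setTI.
- move=> _ _ [A mA <-] [B mB <-]; exists (fun i => A i `&` B i).
    by move=> i; exact: measurableI.
  apply/seteqP; split => x /=.
    by move=> h; split=> i; have [] := h i.
  by move=> [hA hB] i; split; [exact: hA|exact: hB].
- by rewrite bigcup_const.
- by move=> _ [A mA <-]; exact: m12.
Qed.

(** Change of variables when [nu] is a finite mixture of image measures: the
    [i]-th component, of weight [w i], is the image under [phi i] of [mu]
    restricted to [D]. *)
Lemma integral_mixture d1 d2 (X : measurableType d1) (Y : measurableType d2)
    (R : realType) (mu : {measure set X -> \bar R})
    (nu : {measure set Y -> \bar R}) (D : set X) (E : set Y)
    (I : finType) (w : I -> R) (phi : I -> X -> Y) (F : Y -> \bar R) :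
  measurable D -> measurable E ->
  (forall i, 0 <= w i) -> (forall i, measurable_fun setT (phi i)) ->
  (forall i x, D x -> E (phi i x)) ->
  (forall A, measurable A -> A `<=` E ->
    nu A = (\sum_i (w i)%:E * mu (phi i @^-1` A `&` D))%E) ->
  measurable_fun E F -> (forall y, E y -> (0 <= F y)%E) ->
  (\int[nu]_(y in E) F y = \sum_i (w i)%:E * \int[mu]_(x in D) F (phi i x))%E.
Proof.
move=> mD mE w0 mphi DE nuE mF F0.
pose M (i : I) : {measure set Y -> \bar R} :=
  mscale (NngNum (w0 i))
    (measure_function_pushforward__canonical__measure_function_Measure
       (mrestr mu mD) (mphi i)).
pose m_ k : {measure set Y -> \bar R} :=
  if insub k is Some i then M (@enum_val I predT i) else mzero.
rewrite (@eq_measure_integral _ _ _ E (msum m_ #|I|)); last first.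
  move=> A mA AE; rewrite nuE// /msum big_enum_val/=.
  by apply: eq_bigr => i _; rewrite /m_ valK.
rewrite ge0_integral_measure_sum// [RHS]big_enum_val/=.
apply: eq_bigr => i _; rewrite /m_ valK /M ge0_integral_mscale//=; congr (_ * _)%E.
set j := enum_val i.
rewrite ge0_integral_pushforward//; last by move=> y /[!inE]; exact: F0.
have mpre : measurable (phi j @^-1` E).
  by rewrite -[X in measurable X]setTI; exact: (mphi j).
have Dpre : D `<=` phi j @^-1` E by move=> x; exact: DE.
rewrite (ge0_negligible_integral (N := phi j @^-1` E `\` D))//.
- rewrite setDD setIidr//; apply: eq_measure_integral => A mA AD.
  by rewrite /= /mrestr setIidl.
- exact: measurableD.
- by apply: measurable_comp mF _ => //; [move=> _ [x ? <-]|exact: measurable_funTS].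
- by move=> x; exact: F0.
- by rewrite /= /mrestr setDE -setIA setICl setI0 measure0.
Qed.

Section cube_measure.
Context {R : realType}.

Local Notation mu := (@lebesgue_measure R).

Lemma boxE n : @row_of_tuple R n @^-1` cube =
  [set x | forall i, `[0, 1]%classic (tnth x i)].
Proof.
by apply/seteqP; split => x /= h i; have := h i; rewrite mxE in_itv.
Qed.

Lemma measurable_box n : measurable (@row_of_tuple R n @^-1` cube).
Proof.
rewrite boxE (_ : mkset _ =
    \bigcap_i ((@tnth n (measurableTypeR R) ^~ i) @^-1` `[0, 1]%classic)).
  apply: fin_bigcap_measurable => // i _.
  rewrite -[X in measurable X]setTI.
  by apply: (measurable_tnth i measurableT); exact: measurable_itv.
by apply/seteqP; split => x /= h i; [move=> _|]; exact: h.
Qed.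

Lemma lebesgue_tuple_boxI n (A : 'I_n -> set (measurableTypeR R)) :
  (forall i, measurable (A i)) ->
  lebesgue_tuple R n ([set x | forall i, A i (tnth x i)] `&`
                      @row_of_tuple R n @^-1` cube) =
  (\prod_(i < n) mu (A i `&` `[0%R, 1%R]))%E.
Proof.
move=> mA; rewrite -lebesgue_tuple_box; last first.
  by move=> i; apply: measurableI => //; exact: measurable_itv.
rewrite boxE; congr (lebesgue_tuple R n _); apply/seteqP; split => x /=.
  by move=> [h1 h2] i; split; [exact: h1|exact: h2].
by move=> h; split => i; have [] := h i.
Qed.

Lemma lebesgue_unit_itv : mu `[0%R, 1%R]%classic = 1%E.
Proof. by rewrite lebesgue_measure_itv/= lte_fin ltr01 oppr0 adde0. Qed.

Lemma lebesgue_tuple_cube n :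
  lebesgue_tuple R n (@row_of_tuple R n @^-1` cube) = 1%E.
Proof.
rewrite boxE (@lebesgue_tuple_box R n (fun=> `[0, 1]%classic));
  last by move=> i; exact: measurable_itv.
by apply: big1 => i _; exact: lebesgue_unit_itv.
Qed.

(** On rectangles the measures factor over the coordinates, which reduces the
    mixture identity to one dimension in the two cases of interest: marginals
    and subdivisions into grid cells. *)
Lemma cube_mixture n m (I : finType) (w : I -> R)
    (phi : I -> n.-tuple (measurableTypeR R) -> m.-tuple (measurableTypeR R))
    (F : m.-tuple (measurableTypeR R) -> \bar R) :
  (forall i, 0 <= w i) -> (forall i, measurable_fun setT (phi i)) ->
  (forall i x, cube (row_of_tuple x) -> cube (row_of_tuple (phi i x))) ->
  (forall A : 'I_m -> set (measurableTypeR R), (forall i, measurable (A i)) ->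
    (\prod_(a < m) mu (A a `&` `[0%R, 1%R]) = \sum_i (w i)%:E *
      lebesgue_tuple R n (phi i @^-1` [set x | forall a, A a (tnth x a)] `&`
                          @row_of_tuple R n @^-1` cube))%E) ->
  measurable_fun (@row_of_tuple R m @^-1` cube) F ->
  (forall y, cube (row_of_tuple y) -> (0 <= F y)%E) ->
  (\int[lebesgue_tuple R m]_(y in @row_of_tuple R m @^-1` cube) F y =
   \sum_i (w i)%:E * \int[lebesgue_tuple R n]_(x in @row_of_tuple R n @^-1` cube)
     F (phi i x))%E.
Proof.
move=> w0 mphi phic wA mF F0.
apply: integral_mixture => //; [exact: measurable_box|exact: measurable_box|].
move=> A mA AE.
pose M (i : I) : {measure set (m.-tuple (measurableTypeR R)) -> \bar R} :=
  mscale (NngNum (w0 i))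
    (measure_function_pushforward__canonical__measure_function_Measure
       (mrestr (lebesgue_tuple R n) (@measurable_box n)) (mphi i)).
pose m_ k : {measure set (m.-tuple (measurableTypeR R)) -> \bar R} :=
  if insub k is Some i then M (@enum_val I predT i) else mzero.
have msumE B : msum m_ #|I| B = (\sum_i (w i)%:E *
    lebesgue_tuple R n (phi i @^-1` B `&` @row_of_tuple R n @^-1` cube))%E.
  rewrite /msum [RHS]big_enum_val/=.
  by apply: eq_bigr => i _; rewrite /m_ valK.
rewrite -msumE -[in LHS](setIidl AE).
apply: (@tuple_measure_unique R m (mrestr (lebesgue_tuple R m) (@measurable_box m))
  (msum m_ #|I|)) => //=.
  by rewrite /mrestr setTI lebesgue_tuple_cube ltry.
by move=> B mB; rewrite msumE /mrestr lebesgue_tuple_boxI// wA.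
Qed.

End cube_measure.

Section cube_subdivision.
Context {R : realType}.

Local Notation mu := (@lebesgue_measure R).

Lemma lebesgue_measure_affine (a r : R) (A : set (measurableTypeR R)) :
  0 < r -> measurable A ->
  mu A = (r%:E * mu ((fun s => a + r * s)%R @^-1` A))%E.
Proof.
move=> r0 mA.
have mf : measurable_fun [set: measurableTypeR R]
    ((fun s => a + r * s) : _ -> measurableTypeR R).
  apply: measurable_funD; first exact: measurable_cst.
  by apply: measurable_funM; [exact: measurable_cst|exact: measurable_id].
pose m : {measure set (measurableTypeR R) -> \bar R} :=
  mscale (NngNum (ltW r0))
    (measure_function_pushforward__canonical__measure_function_Measure mu mf).
apply: (lebesgue_measure_unique (mu := m)) => // _ [[x y] _ <-].
rewrite [RHS](_ : _ = (r%:E * mu ((fun s => a + r * s)%R @^-1` `]x, y]))%E)//.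
rewrite (_ : _ @^-1` _ = `](x - a) / r, (y - a) / r]%classic); last first.
  apply/seteqP; split => s /=; rewrite !in_itv/= ltr_pdivrMr// ler_pdivlMr//;
    by rewrite ltrBlDl lerBrDl ![r * _]mulrC.
rewrite !lebesgue_measure_itv/= !lte_fin ltr_pM2r ?invr_gt0// ltrD2r.
case: ifPn => _; last by rewrite mule0.
rewrite -!EFinB -EFinM; congr EFin.
by field; rewrite gt_eqF.
Qed.

Lemma lebesgue_measure_itvI (a b : R) (A : set (measurableTypeR R)) :
  a <= b -> measurable A ->
  mu (A `&` `[a, b]) =
  ((b - a)%:E * mu ((fun s => a + (b - a) * s)%R @^-1` A `&` `[0%R, 1%R]))%E.
Proof.
move=> ab mA.
have mAab : measurable (A `&` `[a, b]%classic : set (measurableTypeR R)).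
  by apply: measurableI => //; exact: measurable_itv.
have [abE|anb] := eqVneq a b.
  rewrite abE subrr mul0e; apply/eqP; rewrite -measure_le0.
  rewrite -(lebesgue_measure_set1 b); apply: le_measure; rewrite ?inE//.
  - by rewrite abE in mAab.
  - by move=> x [_] /=; rewrite in_itv/= => /le_anti ->.
have r0 : 0 < b - a by rewrite subr_gt0 lt_neqAle anb.
rewrite (lebesgue_measure_affine a r0)// preimage_setI.
congr (_ * mu (_ `&` _))%E; apply/seteqP; split => s /=; rewrite !in_itv/=.
  by rewrite lerDl pmulr_rge0// -lerBrDl ger_pMr.
by rewrite lerDl pmulr_rge0// -lerBrDl ger_pMr.
Qed.

Lemma lebesgue_measure_subdivision M (t : nat -> R) (A : set (measurableTypeR R)) :
  (forall i, (i < M)%N -> t i <= t i.+1) -> measurable A ->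
  mu (A `&` `[t 0, t M]) = (\sum_(i < M) (t i.+1 - t i)%:E *
    mu ((fun s => t i + (t i.+1 - t i) * s)%R @^-1` A `&` `[0%R, 1%R]))%E.
Proof.
move=> tS mA; elim: M tS => [|M IH] tS.
  rewrite big_ord0 set_itv1; apply/eqP; rewrite -measure_le0.
  rewrite -(lebesgue_measure_set1 (t 0)); apply: le_measure; rewrite ?inE//.
  by apply: measurableI => //; exact: measurable_set1.
rewrite big_ord_recr/= -IH; last by move=> i iM; apply: tS; exact: ltnW.
have t0M : t 0 <= t M.
  elim: M {IH} tS => // M IH tS; apply: le_trans (tS _ _) => //.
  by apply: IH => i iM; apply: tS; exact: ltnW.
have tM : t M <= t M.+1 by exact: tS.
rewrite -lebesgue_measure_itvI//.
have mI (i : interval R) : measurable (A `&` [set` i] : set (measurableTypeR R)).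
  by apply: measurableI => //; exact: measurable_itv.
have mA1 : measurable (A `&` [set t M] : set (measurableTypeR R)).
  by rewrite -(@set_itv1 _ R); exact: mI.
have -> : mu (A `&` `[t M, t M.+1]) = mu (A `&` `]t M, t M.+1]).
  rewrite (_ : `[t M, t M.+1]%classic = [set t M] `|` `]t M, t M.+1]); last first.
    by rewrite -(@set_itv1 _ R) -itv_bndbnd_setU// bnd_simp.
  rewrite setIUr setUC measureU0//.
  apply/eqP; rewrite -measure_le0 -(lebesgue_measure_set1 (t M)).
  by apply: le_measure; rewrite ?inE.
rewrite -measureU//.
  by rewrite -setIUr -itv_bndbnd_setU// bnd_simp.
rewrite setIACA setIid; apply/seteqP; split => x //= -[_].
by rewrite !in_itv/= => -[/andP[_ h] /andP[]]; rewrite ltNge h.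
Qed.
End cube_subdivision.

Section cube_integrals.
Context {R : realType}.

Local Notation mu := (@lebesgue_measure R).
Local Notation box n := (@row_of_tuple R n @^-1` cube).

(** Boundedness on the cube makes all the integrals finite, so that the
    real-valued integral is linear and monotone. *)
Definition cube_integrand n (f : 'rV[R]_n -> R) :=
  measurable_fun (box n) (f \o @row_of_tuple R n) /\
  exists M, forall t, cube t -> `|f t| <= M.

(** The changes of variables of the cube: Borel maps, coordinate by
    coordinate, that preserve it. *)
Definition cube_map n m (psi : 'rV[R]_n -> 'rV[R]_m) :=
  (forall a, measurable_fun [set: n.-tuple (measurableTypeR R)]
     (fun x => psi (row_of_tuple x) 0 a : measurableTypeR R)) /\
  forall s, cube s -> cube (psi s).

Lemma cube_integrand_integrable n (f : 'rV[R]_n -> R) : cube_integrand f ->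
  (lebesgue_tuple R n).-integrable (box n) (EFin \o (f \o @row_of_tuple R n)).
Proof.
move=> [mf [M fM]]; apply: measurable_bounded_integrable => //.
- exact: measurable_box.
- rewrite [X in (X < _)%E](_ : _ = 1%E) ?ltry//; exact: lebesgue_tuple_cube.
- exists M; split; first exact: num_real.
  by move=> x Mx y cy; apply: le_trans (ltW Mx); exact: fM.
Qed.


Lemma cube_integral_cst n (a : R) :
  cube_integral (fun _ : 'rV[R]_n => a) = a.
Proof.
rewrite /cube_integral Rintegral_cst; last exact: measurable_box.
rewrite [X in fine X](_ : _ = 1%E) ?mulr1//; exact: lebesgue_tuple_cube.
Qed.

Lemma cube_integrand_cst n (a : R) : cube_integrand (fun _ : 'rV[R]_n => a).
Proof. by split; [exact: measurable_cst|exists `|a|]. Qed.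

Lemma eq_cube_integral n (f g : 'rV[R]_n -> R) :
  (forall t, cube t -> f t = g t) -> cube_integral f = cube_integral g.
Proof. by move=> fg; apply: eq_Rintegral => x /[!inE]; exact: fg. Qed.

Lemma eq_cube_integrand n (f g : 'rV[R]_n -> R) :
  (forall t, cube t -> f t = g t) -> cube_integrand f -> cube_integrand g.
Proof.
move=> fg [mf [M fM]]; split; last first.
  by exists M => t ct; rewrite -fg//; exact: fM.
by apply: eq_measurable_fun mf => x /[!inE] cx; rewrite /= fg.
Qed.

Lemma cube_integrandB n (f g : 'rV[R]_n -> R) :
  cube_integrand f -> cube_integrand g -> cube_integrand (fun t => f t - g t).
Proof.
move=> [mf [M fM]] [mg [N gN]]; split; first exact: measurable_funB.
exists (M + N) => t ct; apply: le_trans (ler_normB _ _) _.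
by apply: lerD; [exact: fM|exact: gN].
Qed.

Lemma cube_integrandD n (f g : 'rV[R]_n -> R) :
  cube_integrand f -> cube_integrand g -> cube_integrand (fun t => f t + g t).
Proof.
move=> [mf [M fM]] [mg [N gN]]; split; first exact: measurable_funD.
exists (M + N) => t ct; apply: le_trans (ler_normD _ _) _.
by apply: lerD; [exact: fM|exact: gN].
Qed.

Lemma cube_integrandZ n (a : R) (f : 'rV[R]_n -> R) :
  cube_integrand f -> cube_integrand (fun t => a * f t).
Proof.
move=> [mf [M fM]]; split.
  by apply: measurable_funM => //; exact: measurable_cst.
by exists (`|a| * M) => t ct; rewrite normrM ler_wpM2l//; exact: fM.
Qed.

Lemma cube_integrand_sum n (I : Type) (r : seq I) (f : I -> 'rV[R]_n -> R) :
  (forall i, cube_integrand (f i)) ->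
  cube_integrand (fun t => \sum_(i <- r) f i t).
Proof.
move=> hf; elim: r => [|i r IH].
  by apply: eq_cube_integrand (cube_integrand_cst n 0) => t _; rewrite big_nil.
apply: eq_cube_integrand (cube_integrandD (hf i) IH) => t _.
by rewrite big_cons.
Qed.

Lemma cube_integralZ n (a : R) (f : 'rV[R]_n -> R) : cube_integrand f ->
  cube_integral (fun t => a * f t) = a * cube_integral f.
Proof.
move=> hf; apply: RintegralZl; first exact: measurable_box.
exact: cube_integrand_integrable.
Qed.

Lemma cube_integralD n (f g : 'rV[R]_n -> R) :
  cube_integrand f -> cube_integrand g ->
  cube_integral (fun t => f t + g t) = cube_integral f + cube_integral g.
Proof.
move=> hf hg; apply: RintegralD; first exact: measurable_box.
  exact: cube_integrand_integrable.
exact: cube_integrand_integrable.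
Qed.

Lemma cube_integral_sum n (I : Type) (r : seq I) (f : I -> 'rV[R]_n -> R) :
  (forall i, cube_integrand (f i)) ->
  cube_integral (fun t => \sum_(i <- r) f i t) =
  \sum_(i <- r) cube_integral (f i).
Proof.
move=> hf; elim: r => [|i r IH].
  rewrite big_nil -[RHS](cube_integral_cst n).
  by apply: eq_cube_integral => t _; rewrite big_nil.
rewrite big_cons -IH -cube_integralD//; last exact: cube_integrand_sum.
by apply: eq_cube_integral => t _; rewrite big_cons.
Qed.

Lemma le_cube_integral n (f g : 'rV[R]_n -> R) :
  cube_integrand f -> cube_integrand g ->
  (forall t, cube t -> f t <= g t) -> cube_integral f <= cube_integral g.
Proof.
move=> hf hg fg; apply: le_Rintegral; first exact: measurable_box.
- exact: cube_integrand_integrable.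
- exact: cube_integrand_integrable.
- by move=> x cx; exact: fg.
Qed.

Lemma cube_integral_ge0 n (f : 'rV[R]_n -> R) :
  (forall t, cube t -> 0 <= f t) -> 0 <= cube_integral f.
Proof. by move=> f0; apply: Rintegral_ge0 => x; exact: f0. Qed.

Lemma cube_integral_dist n (f g : 'rV[R]_n -> R) delta :
  cube_integrand f -> cube_integrand g ->
  (forall t, cube t -> `|f t - g t| <= delta) ->
  `|cube_integral f - cube_integral g| <= delta.
Proof.
move=> hf hg fg; have hd := cube_integrand_cst n delta.
rewrite ler_distl -[delta](cube_integral_cst n).
have -> : cube_integral g - cube_integral (fun _ : 'rV_n => delta) =
    cube_integral (fun t => g t - delta).
  rewrite !cube_integral_cst -[X in _ - X](cube_integral_cst n).
  apply/esym/RintegralB; first exact: measurable_box.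
    exact: cube_integrand_integrable.
  exact: cube_integrand_integrable.
rewrite -cube_integralD//; apply/andP; split; apply: le_cube_integral => //.
- exact: cube_integrandB.
- by move=> t ct; have := fg t ct; rewrite ler_distl => /andP[].
- exact: cube_integrandD.
- by move=> t ct; have := fg t ct; rewrite ler_distl => /andP[].
Qed.

Let tuple_of_row n (v : 'rV[R]_n) : n.-tuple (measurableTypeR R) :=
  [tuple v 0 a | a < n].

Let tuple_of_rowK n : cancel (@tuple_of_row n) (@row_of_tuple R n).
Proof. by move=> v; apply/rowP => a; rewrite mxE tnth_mktuple. Qed.

Let measurable_cube_map n m (psi : 'rV[R]_n -> 'rV[R]_m) : cube_map psi ->
  measurable_fun setT (fun x => tuple_of_row (psi (row_of_tuple x))).
Proof.
move=> [mpsi _]; apply/measurable_fun_tnthP => a.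
apply: (eq_measurable_fun (fun x => psi (row_of_tuple x) 0 a)).
  by move=> x _; rewrite /= tnth_mktuple.
exact: (mpsi a).
Qed.

Lemma cube_integrand_comp n m (psi : 'rV[R]_n -> 'rV[R]_m) (f : 'rV[R]_m -> R) :
  cube_map psi -> cube_integrand f -> cube_integrand (f \o psi).
Proof.
move=> hpsi [mf [M fM]]; have [_ cpsi] := hpsi; split; last first.
  by exists M => t ct; apply: fM; exact: cpsi.
rewrite (_ : _ \o _ = (f \o @row_of_tuple R m) \o
   (fun x => tuple_of_row (psi (row_of_tuple x)))); last first.
  by apply/funext => x /=; rewrite tuple_of_rowK.
apply: measurable_comp mf _ => //.
- exact: measurable_box.
- by move=> _ [x cx <-]; rewrite /preimage/= tuple_of_rowK; exact: cpsi.
- by apply: measurable_funTS; exact: measurable_cube_map.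
Qed.

Lemma cube_integral_mixture n m (I : finType) (w : I -> R)
    (psi : I -> 'rV[R]_n -> 'rV[R]_m) (f : 'rV[R]_m -> R) :
  (forall i, 0 <= w i) -> (forall i, cube_map (psi i)) ->
  (forall A : 'I_m -> set (measurableTypeR R), (forall i, measurable (A i)) ->
    (\prod_(a < m) mu (A a `&` `[0%R, 1%R]) = \sum_i (w i)%:E *
      lebesgue_tuple R n ([set x | forall a, A a (psi i (row_of_tuple x) 0%R a)]
                          `&` box n))%E) ->
  cube_integrand f -> (forall t, cube t -> 0 <= f t) ->
  cube_integral f = \sum_i w i * cube_integral (f \o psi i).
Proof.
move=> w0 hpsi wA hf f0.
rewrite /cube_integral /Rintegral.
rewrite (@cube_mixture R n m I w (fun i x => tuple_of_row (psi i (row_of_tuple x)))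
   (EFin \o (f \o @row_of_tuple R m)))//.
- under eq_bigr => i _.
    rewrite (_ : integral _ _ _ = (cube_integral (f \o psi i))%:E); last first.
      rewrite /cube_integral /Rintegral fineK; last first.
        exact: (integrable_fin_num (@measurable_box R n)
          (cube_integrand_integrable (cube_integrand_comp (hpsi i) hf))).
      by apply: eq_integral => x _ /=; rewrite tuple_of_rowK.
    rewrite -EFinM; over.
  by rewrite sumEFin.
- by move=> i; exact: measurable_cube_map.
- by move=> i x cx; rewrite tuple_of_rowK; apply: (hpsi i).2.
- move=> A mA; rewrite wA//; apply: eq_bigr => i _; congr (_ * _)%E.
  congr (lebesgue_tuple R n (_ `&` _)); apply/seteqP; split => x /= h a.
    by rewrite tnth_mktuple.
  by have := h a; rewrite tnth_mktuple.
- by apply/measurable_EFinP; case: hf.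
- by move=> x cx; rewrite lee_fin f0.
Qed.

Lemma measurable_coord n (a : 'I_n) :
  measurable_fun [set: n.-tuple (measurableTypeR R)]
    (fun x => row_of_tuple x 0 a : measurableTypeR R).
Proof.
apply: (eq_measurable_fun (fun x => tnth x a)); last exact: measurable_tnth.
by move=> x _; rewrite mxE.
Qed.

Lemma cube_map_colsub n m (sigma : 'I_m -> 'I_n) :
  cube_map (fun s : 'rV[R]_n => colsub sigma s).
Proof.
split=> [a|s cs a]; last by rewrite mxE.
apply: (eq_measurable_fun (fun x => row_of_tuple x 0 (sigma a))).
  by move=> x _; rewrite !mxE.
exact: measurable_coord.
Qed.

(** Integrating out a coordinate on which the integrand does not depend
    contributes a factor 1, the length of the unit interval. *)
Lemma cube_integral_colsub n m (sigma : 'I_m -> 'I_n) (f : 'rV[R]_m -> R) :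
  injective sigma -> cube_integrand f -> (forall t, cube t -> 0 <= f t) ->
  cube_integral (fun s => f (colsub sigma s)) = cube_integral f.
Proof.
move=> injs hf f0.
rewrite [RHS](@cube_integral_mixture n m 'I_1 (fun=> 1)
  (fun _ s => colsub sigma s))//; first by rewrite big_ord1 mul1r.
  by move=> _; exact: cube_map_colsub.
move=> A mA; rewrite big_ord1 mul1e.
(* the cylinder over [A]: coordinates outside the range of [sigma] are free *)
pose A' i : set (measurableTypeR R) :=
  if [pick a | sigma a == i] is Some a then A a else setT.
have A'E a : A' (sigma a) = A a.
  by rewrite /A'; case: pickP => [b /eqP/injs ->//|/(_ a)]; rewrite eqxx.
have mA' i : measurable (A' i) by rewrite /A'; case: pickP.
transitivity (\prod_(i < n) mu (A' i `&` `[0%R, 1%R]))%E.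
  rewrite [RHS](bigID (mem (codom sigma)))/= [X in (_ * X)%E]big1 ?mule1.
    rewrite (eq_bigl (fun i => i \in sigma @: 'I_m)); last first.
      move=> i; apply/idP/idP => [/codomP[a ->]|/imsetP[a _ ->]].
        exact: imset_f.
      exact: codom_f.
    rewrite big_imset/=; last by move=> a b _ _; exact: injs.
    by apply: eq_bigr => a _; rewrite A'E.
  move=> i iN; rewrite /A'; case: pickP => [a /eqP ai|_].
    by move: iN; rewrite -ai codom_f.
  by rewrite setTI lebesgue_unit_itv.
rewrite -lebesgue_tuple_boxI//; congr (lebesgue_tuple R n (_ `&` _)).
apply/seteqP; split => x /= h i.
  by have := h (sigma i); rewrite A'E !mxE.
rewrite /A'; case: pickP => // a /eqP ai.
by have := h a; rewrite !mxE ai.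
Qed.

(** One grid cell contributes its volume times an integral over the unit cube:
    the cell is the image of the cube under an affine map. *)
Lemma cube_integral_subdivision n M (t : 'I_n -> nat -> R) (f : 'rV[R]_n -> R) :
  (forall m, t m 0 = 0) -> (forall m, t m M = 1) ->
  (forall m i, (i < M)%N -> t m i <= t m i.+1) ->
  cube_integrand f -> (forall x, cube x -> 0 <= f x) ->
  let cell (i : {ffun 'I_n -> 'I_M}) (s : 'rV[R]_n) :=
    \row_m (t m (i m) + (t m (i m).+1 - t m (i m)) * s 0 m) in
  (forall i, cube_map (cell i)) /\
  cube_integral f = \sum_(i : {ffun 'I_n -> 'I_M})
    (\prod_m (t m (i m).+1 - t m (i m))) * cube_integral (f \o cell i).
Proof.
move=> t0 tM tS hf f0 cell.
have tmon m i j : (i <= j)%N -> (j <= M)%N -> t m i <= t m j.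
  elim: j => [|j IH]; first by rewrite leqn0 => /eqP ->.
  rewrite leq_eqVlt => /predU1P[->//|ij] jM.
  by apply: le_trans (tS m j jM); apply: IH => //; exact: ltnW.
have r0 m (i : 'I_M) : 0 <= t m i.+1 - t m i by rewrite subr_ge0 tS.
have hcell i : cube_map (cell i).
  split=> [a|s cs a].
    apply: (eq_measurable_fun (fun x =>
        t a (i a) + (t a (i a).+1 - t a (i a)) * row_of_tuple x 0 a)).
      by move=> x _; rewrite [RHS]mxE.
    apply: measurable_funD; first exact: measurable_cst.
    by apply: measurable_funM; [exact: measurable_cst|exact: measurable_coord].
  rewrite mxE; have /andP[s0 s1] := cs a; apply/andP; split.
    by rewrite addr_ge0 ?mulr_ge0 ?r0// -(t0 a) tmon// ltnW.
  rewrite -(tM a); apply: le_trans (tmon a (i a).+1 M _ _) => //.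
  by rewrite -lerBrDl ler_piMr.
split=> //; apply: cube_integral_mixture => //.
  by move=> i; apply: prodr_ge0 => m _; exact: r0.
move=> A mA.
pose pre m (i : 'I_M) : set (measurableTypeR R) :=
  (fun s => t m i + (t m i.+1 - t m i) * s) @^-1` A m.
have mpre m i : measurable (pre m i).
  have mf : measurable_fun [set: measurableTypeR R]
      ((fun s => t m i + (t m i.+1 - t m i) * s) : _ -> measurableTypeR R).
    apply: measurable_funD; first exact: measurable_cst.
    by apply: measurable_funM; [exact: measurable_cst|exact: measurable_id].
  by rewrite -[X in measurable X]setTI; exact: (mf measurableT _ (mA m)).
have fin (B : set (measurableTypeR R)) : measurable B ->
    mu (B `&` `[0%R, 1%R]) \is a fin_num.
  move=> mB; rewrite ge0_fin_numE//; apply: le_lt_trans (_ : (1 < +oo)%E).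
    rewrite -[leRHS](@lebesgue_unit_itv R); apply: le_measure; rewrite ?inE//.
    by apply: measurableI => //; exact: measurable_itv.
  by rewrite ltry.
have -> : (\prod_(m < n) mu (A m `&` `[0%R, 1%R]))%E =
    (\prod_(m < n) \sum_(i < M)
      (t m i.+1 - t m i) * fine (mu (pre m i `&` `[0%R, 1%R])))%:E.
  rewrite -prodEFin; apply: eq_bigr => m _.
  have := lebesgue_measure_subdivision (tS m) (mA m); rewrite t0 tM => ->.
  rewrite -sumEFin; apply: eq_bigr => i _.
  by rewrite EFinM fineK// fin.
rewrite bigA_distr_bigA -sumEFin; apply: eq_bigr => i _.
rewrite big_split EFinM; congr (_ * _)%E.
rewrite -prodEFin.
transitivity (\prod_(m < n) mu (pre m (i m) `&` `[0%R, 1%R]))%E.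
  by apply: eq_bigr => m _; rewrite fineK// fin.
rewrite -lebesgue_tuple_boxI//; congr (lebesgue_tuple R n (_ `&` _)).
by apply/seteqP; split => x /= h m; have := h m; rewrite /pre/= !mxE.
Qed.

End cube_integrals.

(** * Continuous functions on the cube *)

Section cube_continuity.
Context {R : realType}.

Local Notation box n := (@row_of_tuple R n @^-1` cube).

Definition cube_continuous n (f : 'rV[R]_n -> R) :=
  forall t, cube t -> f s @[s --> within cube (nbhs t)] --> f t.

Lemma cube_continuousE n (f : 'rV[R]_n -> R) :
  {within unit_cube n, continuous f} <-> cube_continuous f.
Proof. exact: subspace_continuousP. Qed.

Lemma nbhs_rowP n (t : 'rV[R]_n) (A : set 'rV[R]_n) :
  nbhs t A <-> exists2 d : R, 0 < d &
    forall s : 'rV[R]_n, (forall i, `|s 0 i - t 0 i| < d) -> A s.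
Proof.
split=> [/nbhs_ballP[d /= d0 dA]|[d d0 dA]].
  exists d => // s st; apply: dA; split=> // i j; rewrite ord1.
  by rewrite /ball/= distrC; exact: st.
apply/nbhs_ballP; exists d => //= s [_ ts]; apply: dA => i.
by rewrite distrC; exact: (ts 0 i).
Qed.

Lemma cube_continuousP n (f : 'rV[R]_n -> R) : cube_continuous f <->
  forall t, cube t -> forall e : R, 0 < e -> exists2 d : R, 0 < d &
    forall s, cube s -> (forall i, `|s 0 i - t 0 i| < d) -> `|f s - f t| < e.
Proof.
split=> cf t ct.
  move=> e e0; have /cvgrPdist_lt/(_ e e0) := cf t ct.
  rewrite near_withinE => /nbhs_rowP[d d0 dA]; exists d => // s cs st.
  by rewrite distrC; exact: dA.
apply/cvgrPdist_lt => e e0; rewrite near_withinE; apply/nbhs_rowP.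
have [d d0 dA] := cf t ct e e0; exists d => // s st cs.
by rewrite distrC; exact: dA.
Qed.

Lemma cube_continuous_cst n (a : R) : cube_continuous (fun _ : 'rV[R]_n => a).
Proof. by move=> t _; exact: cvg_cst. Qed.

Lemma cube_continuous_coord n (a : 'I_n) :
  cube_continuous (fun s : 'rV[R]_n => s 0 a).
Proof.
apply/cube_continuousP => t _ e e0; exists e => // s _; exact.
Qed.

Lemma cube_continuousD n (f g : 'rV[R]_n -> R) : cube_continuous f ->
  cube_continuous g -> cube_continuous (fun t => f t + g t).
Proof. by move=> cf cg t ct; apply: cvgD; [exact: cf|exact: cg]. Qed.

Lemma cube_continuousN n (f : 'rV[R]_n -> R) : cube_continuous f ->
  cube_continuous (fun t => - f t).
Proof. by move=> cf t ct; apply: cvgN; exact: cf. Qed.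

Lemma cube_continuousM n (f g : 'rV[R]_n -> R) : cube_continuous f ->
  cube_continuous g -> cube_continuous (fun t => f t * g t).
Proof. by move=> cf cg t ct; apply: cvgM; [exact: cf|exact: cg]. Qed.

Lemma cube_continuousX n (f : 'rV[R]_n -> R) (m : nat) : cube_continuous f ->
  cube_continuous (fun t => f t ^+ m).
Proof.
move=> cf; elim: m => [|m IH]; first exact: cube_continuous_cst.
have := cube_continuousM cf IH.
by congr cube_continuous; apply/funext => t; rewrite exprS.
Qed.

Lemma cube_continuous_sum n (I : Type) (r : seq I) (f : I -> 'rV[R]_n -> R) :
  (forall i, cube_continuous (f i)) ->
  cube_continuous (fun t => \sum_(i <- r) f i t).
Proof.
move=> cf; elim: r => [|i r IH].
  have := @cube_continuous_cst n 0.
  by congr cube_continuous; apply/funext => t; rewrite big_nil.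
have := cube_continuousD (cf i) IH.
by congr cube_continuous; apply/funext => t; rewrite big_cons.
Qed.

Lemma cube_continuous_prod n (I : Type) (r : seq I) (f : I -> 'rV[R]_n -> R) :
  (forall i, cube_continuous (f i)) ->
  cube_continuous (fun t => \prod_(i <- r) f i t).
Proof.
move=> cf; elim: r => [|i r IH].
  have := @cube_continuous_cst n 1.
  by congr cube_continuous; apply/funext => t; rewrite big_nil.
have := cube_continuousM (cf i) IH.
by congr cube_continuous; apply/funext => t; rewrite big_cons.
Qed.

Lemma cube_continuousV n (f : 'rV[R]_n -> R) : cube_continuous f ->
  (forall t, cube t -> f t != 0) -> cube_continuous (fun t => (f t)^-1).
Proof. by move=> cf f0 t ct; apply: cvgV; [exact: f0|exact: cf]. Qed.

Lemma cube_continuous_interp n (g : 'rV[R]_n -> 'rV[R]_n -> R) :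
  (forall y, cube y -> cube_continuous (g ^~ y)) ->
  cube_continuous (interp_error g).
Proof.
move=> cg.
have cw (e : {ffun 'I_n -> bool}) : cube_continuous (fun s : 'rV[R]_n =>
    \prod_i (s 0 i ^+ e i * (1 - s 0 i) ^+ (~~ e i))).
  apply: cube_continuous_prod => i; apply: cube_continuousM.
    by apply: cube_continuousX; exact: cube_continuous_coord.
  apply: cube_continuousX; apply: cube_continuousD.
    exact: cube_continuous_cst.
  by apply: cube_continuousN; exact: cube_continuous_coord.
have cM (f : 'rV[R]_n -> 'rV[R]_n -> R) :
    (forall y, cube y -> cube_continuous (f ^~ y)) ->
    cube_continuous (fun s => bernoulli_mean s (f s)).
  move=> cf; apply: cube_continuous_sum => e.
  apply: cube_continuousM; last exact: cw.
  by apply: cf; exact: vertex_cube.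
apply: cube_continuousD; first exact: cM.
apply: cube_continuousN; apply: cube_continuousM.
  exact: cube_continuous_cst.
apply: (cM (fun s x => bernoulli_mean s (g x))) => x _.
by apply: (cM (fun s => g x)) => y _; exact: cube_continuous_cst.
Qed.

Lemma cube_compact n : compact (unit_cube n : set 'rV[R]_n).
Proof.
have := @rV_compact R n (fun=> `[0, 1]%classic) (fun=> @segment_compact R 0 1).
congr compact; apply/seteqP; split => t /= h i; have := h i;
  by rewrite in_itv.
Qed.

Lemma cube0 n : cube (0 : 'rV[R]_n).
Proof. by move=> i; rewrite mxE lexx ler01. Qed.

Lemma cube_continuous_max n (f : 'rV[R]_n -> R) : cube_continuous f ->
  exists2 t, cube t & forall s, cube s -> f s <= f t.
Proof.
move=> /cube_continuousE cf.
have [|t /[!inE] ct tm] := compact_EVT_max _ (@cube_compact n) cf.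
  by exists 0; exact: cube0.
by exists t => // s cs; apply: tm; rewrite inE.
Qed.

Lemma cube_continuous_min n (f : 'rV[R]_n -> R) : cube_continuous f ->
  exists2 t, cube t & forall s, cube s -> f t <= f s.
Proof.
move=> /cube_continuousN/cube_continuous_max[t ct tm].
by exists t => // s cs; have := tm s cs; rewrite lerN2.
Qed.

(** Heine-Cantor, by the near-covering form of compactness applied to the
    radii that work near a given point. *)
Lemma cube_unif_continuous n (f : 'rV[R]_n -> R) : cube_continuous f ->
  forall e : R, 0 < e -> exists2 d : R, 0 < d & forall s t, cube s -> cube t ->
    (forall i, `|s 0 i - t 0 i| < d) -> `|f s - f t| < e.
Proof.
move=> /cube_continuousP cf e e0.
pose P (d : R) (t : 'rV[R]_n) := cube t -> forall s, cube s ->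
  (forall i, `|s 0 i - t 0 i| < d) -> `|f s - f t| < e.
have /compact_near_coveringP/(_ _ (0^'+) P _) cov := @cube_compact n.
have : \forall d \near (0 : R)^'+, unit_cube n `<=` P d.
  apply: cov => t ct; have [|d d0 dA] := cf t ct (e / 2); first by rewrite divr_gt0.
  have d20 : 0 < d / 2 by rewrite divr_gt0.
  exists ([set x : 'rV[R]_n | forall i, `|x 0 i - t 0 i| < d / 2],
          [set r | r < d / 2]).
    split; first by apply/nbhs_rowP; exists (d / 2).
    exact: nbhs_right_lt.
  move=> [x r] [/= xt rd] cx s cs sx.
  have -> : f s - f x = (f s - f t) - (f x - f t) by ring.
  apply: le_lt_trans (ler_normB _ _) _; rewrite [e]splitr; apply: ltrD.
    apply: dA => // i; rewrite -(subrK (x 0 i) (s 0 i)) -addrA.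
    apply: le_lt_trans (ler_normD _ _) _; rewrite [d]splitr ltrD//.
    exact: lt_trans (sx i) rd.
  apply: dA => // i; apply: lt_trans (xt i) _.
  by rewrite ltr_pdivrMr// ltr_pMr// ltr1n.
move=> covP; have posP : \forall d \near (0 : R)^'+, 0 < d.
  exact: nbhs_right_gt.
have [d [d0 dP]] := filter_ex (filterI posP covP).
exists d => // s t cs ct st.
exact: (dP t ct ct s cs st).
Qed.

Lemma measurable_fun_fin_cover d1 d2 (T : measurableType d1)
    (U : measurableType d2) (I : finType) (D : set T) (C : I -> set T)
    (f : T -> U) :
  (forall i, measurable (C i)) -> (forall i, C i `<=` D) ->
  (forall x, D x -> exists i, C i x) ->
  (forall i, measurable_fun (C i) f) -> measurable_fun D f.
Proof.
move=> mC CD DC mf mD A mA.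
rewrite (_ : D `&` f @^-1` A = \bigcup_(i in setT) (C i `&` f @^-1` A)).
  by apply: fin_bigcup_measurable => // i _; exact: mf.
apply/seteqP; split => x /=.
  by move=> [Dx Ax]; have [i Cx] := DC x Dx; exists i.
by move=> [i _ [Cx Ax]]; split => //; exact: CD Cx.
Qed.

Lemma measurable_box_coord n (J : 'I_n -> interval R) :
  measurable (box n `&` [set x | forall m, row_of_tuple x 0 m \in J m]).
Proof.
apply: measurableI; first exact: measurable_box.
rewrite (_ : mkset _ = \bigcap_m
    ((fun x => row_of_tuple x 0 m : measurableTypeR R) @^-1` [set` J m])).
  apply: fin_bigcap_measurable => // m _.
  rewrite -[X in measurable X]setTI.
  by apply: (measurable_coord m measurableT); exact: measurable_itv.
by apply/seteqP; split => x /= h m; [move=> _|]; exact: h.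
Qed.

(** Sampling a continuous function on finer and finer grids gives
    step functions that converge to it pointwise. *)
Lemma cube_continuous_measurable n (f : 'rV[R]_n -> R) : cube_continuous f ->
  measurable_fun (box n) (f \o @row_of_tuple R n).
Proof.
move=> /cube_continuousP cf.
pose D (M : nat) (t : 'rV[R]_n) : 'rV[R]_n :=
  \row_i ((Num.truncn (M.+1%:R * t 0 i))%:R / M.+1%:R).
have D_itv M (t : 'rV[R]_n) i :
    cube t -> D M t 0 i <= t 0 i < D M t 0 i + M.+1%:R^-1.
  move=> ct; have /andP[t0 _] := ct i.
  have := truncn_itv (mulr_ge0 (ler0n R M.+1) t0).
  rewrite mxE -[X in _ + X]mul1r -mulrDl natr1 => /andP[h1 h2].
  by rewrite ler_pdivrMr// ltr_pdivlMr// ![_ 0 i * _]mulrC h1.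
have Dcube M t : cube t -> cube (D M t).
  move=> ct i; have /andP[t0 t1] := ct i; have /andP[Dt _] := D_itv M t i ct.
  by rewrite (le_trans Dt t1) andbT mxE divr_ge0.
apply: (@measurable_fun_cvg _ _ _ _ (fun M => f \o D M \o @row_of_tuple R n)).
  move=> M.
  pose J (i : 'I_M.+2) : interval R :=
    `[i%:R / M.+1%:R, i%:R / M.+1%:R + M.+1%:R^-1[.
  pose C (i : {ffun 'I_n -> 'I_M.+2}) :=
    box n `&` [set x | forall m, row_of_tuple x 0 m \in J (i m)].
  apply: (@measurable_fun_fin_cover _ _ _ _ _ _ C).
  - by move=> i; exact: measurable_box_coord.
  - by move=> i x [].
  - move=> x cx.
    have tM m : (Num.truncn (M.+1%:R * row_of_tuple x 0 m)%R < M.+2)%N.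
      have /andP[x0 x1] := cx m.
      rewrite truncn_lt_nat ?mulr_ge0//; apply: le_lt_trans (_ : M.+1%:R < _).
        by rewrite ler_piMr.
      by rewrite ltr_nat.
    exists [ffun m => Ordinal (tM m)]; split=> //= m; rewrite ffunE in_itv/=.
    by have := D_itv M _ m cx; rewrite mxE.
  - move=> i; apply: (eq_measurable_fun
        (cst (f (\row_m ((i m)%:R / M.+1%:R))))); last exact: measurable_cst.
    move=> x /[!inE] -[cx xJ]; rewrite /cst/=; congr f.
    apply/rowP => m; rewrite mxE [RHS]mxE; congr (_%:R / _); apply/esym.
    apply: truncn_def; have := xJ m.
    rewrite in_itv/= -[X in _ + X]mul1r -mulrDl natr1.
    by rewrite ler_pdivrMr// ltr_pdivlMr// mulrC.
move=> x cx; set t := row_of_tuple x.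
apply/cvgrPdist_lt => e e0; have [d d0 dA] := cf t cx e e0.
near=> M; rewrite /= distrC; apply: dA; first exact: Dcube.
move=> i; have /andP[h1 h2] := D_itv M t i cx.
rewrite distrC ger0_norm ?subr_ge0//.
apply: (@lt_trans _ _ (M.+1%:R^-1)); first by rewrite ltrBlDl.
by near: M; exact: near_infty_natSinv_lt (PosNum d0).
Unshelve. all: end_near. Qed.

Lemma cube_continuous_integrand n (f : 'rV[R]_n -> R) :
  cube_continuous f -> cube_integrand f.
Proof.
move=> cf; split; first exact: cube_continuous_measurable.
have [t1 _ h1] := cube_continuous_max cf.
have [t2 _ h2] := cube_continuous_min cf.
exists (`|f t1| + `|f t2|) => t ct.
have := h1 t ct; have := h2 t ct.
have := ler_norm (f t1); have := ler_norm (- f t2); rewrite normrN.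
have := normr_ge0 (f t1); have := normr_ge0 (f t2).
by rewrite ler_norml; lra.
Qed.

End cube_continuity.

Section cube_positivity.
Context {R : realType}.

(** Around a point where [f > 0] there is a box on which [f] is bounded below;
    its faces subdivide the cube into cells of which this box is one. *)
Lemma cube_integral_gt0 n (f : 'rV[R]_n -> R) (x : 'rV[R]_n) :
  cube_continuous f -> (forall t, cube t -> 0 <= f t) -> cube x -> 0 < f x ->
  0 < cube_integral f.
Proof.
move=> cf f0 cx fx.
have [|d d0 fd] := (cube_continuousP f).1 cf x cx (f x / 2).
  by rewrite divr_gt0.
pose a m := Num.max 0 (x 0 m - d / 2).
pose b m := Num.min 1 (x 0 m + d / 2).
pose t m i := nth 1 [:: 0; a m; b m] i.
have d20 : 0 < d / 2 by rewrite divr_gt0.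
have a0 m : 0 <= a m by rewrite le_max lexx.
have b1 m : b m <= 1 by rewrite ge_min lexx.
have ax m : a m <= x 0 m.
  by have /andP[x0 _] := cx m; rewrite ge_max x0 gerBl ltW.
have xb m : x 0 m <= b m.
  by have /andP[_ x1] := cx m; rewrite le_min x1 lerDl ltW.
have ab m : a m < b m.
  rewrite lt_min !gt_max; have /andP[x0 x1] := cx m.
  apply/and3P; split; lra.
have hf := cube_continuous_integrand cf.
have [||m i iM|hcell ->] := @cube_integral_subdivision R n 3 t f _ _ _ hf f0.
- by [].
- by [].
- by case: i iM => [|[|[|]]]//= _; rewrite /t/=; [exact: a0|exact: ltW|exact: b1].
pose i1 : {ffun 'I_n -> 'I_3} := [ffun=> inord 1].
rewrite (bigD1 i1)//=; apply: ltr_wpDr.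
  apply: sumr_ge0 => i _; apply: mulr_ge0.
    apply: prodr_ge0 => m _; rewrite subr_ge0 /t.
    by case: (i m) => -[|[|[|]]]//= _; exact: ltW.
  by apply: cube_integral_ge0 => s cs; apply: f0; apply: (hcell i).2.
apply: mulr_gt0.
  by apply: prodr_gt0 => m _; rewrite ffunE inordK// /t/= subr_gt0.
apply: (@lt_le_trans _ _ (f x / 2)); first by rewrite divr_gt0.
rewrite -[leLHS](@cube_integral_cst R n); apply: le_cube_integral.
- exact: cube_integrand_cst.
- exact: cube_integrand_comp.
move=> s cs /=; set y := \row_m _.
have cy : cube y by apply: (hcell i1).2.
suff : `|f y - f x| < f x / 2 by rewrite ltr_distl => /andP[h _]; lra.
apply: fd => // m; rewrite mxE ffunE inordK// /t/=.
have /andP[s0 s1] := cs m.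
have h1 : a m <= a m + (b m - a m) * s 0 m.
  by rewrite lerDl mulr_ge0// subr_ge0 ltW.
have h2 : a m + (b m - a m) * s 0 m <= b m.
  by rewrite -lerBrDl ler_piMr// subr_ge0 ltW.
have h3 : x 0 m - d / 2 <= a m by rewrite le_max lexx orbT.
have h4 : b m <= x 0 m + d / 2 by rewrite ge_min lexx orbT.
rewrite ltr_distl; apply/andP; split; lra.
Qed.

End cube_positivity.

(** * Second moments and the mean square interpolation error *)

Section Rintegral_sums.
Context d (T : measurableType d) (R : realType)
  (mu : {measure set T -> \bar R}).

Lemma integrable_sumEFin (D : set T) (I : Type) (r : seq I) (f : I -> T -> R) :
  measurable D -> (forall i, mu.-integrable D (EFin \o f i)) ->
  mu.-integrable D (EFin \o (fun x => \sum_(i <- r) f i x)).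
Proof.
move=> mD hf; apply: (eq_integrable mD
    (fun x => \sum_(i <- r) (EFin \o f i) x)%E).
  by move=> x _; rewrite /= sumEFin.
exact: integrable_sum.
Qed.

Lemma Rintegral_sum (D : set T) (I : Type) (r : seq I) (f : I -> T -> R) :
  measurable D -> (forall i, mu.-integrable D (EFin \o f i)) ->
  \int[mu]_(x in D) (\sum_(i <- r) f i x) = \sum_(i <- r) \int[mu]_(x in D) f i x.
Proof.
move=> mD hf; elim: r => [|i r IH].
  under eq_Rintegral do rewrite big_nil.
  by rewrite big_nil [LHS](@Rintegral_cst _ _ _ mu _ mD 0) mul0r.
under eq_Rintegral do rewrite big_cons.
by rewrite RintegralD// ?IH ?big_cons//; exact: integrable_sumEFin.
Qed.

End Rintegral_sums.

Section second_moments.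
Context {R : realType} d {Omega : measurableType d} (P : probability Omega R).
Implicit Types f g : Omega -> R.

Lemma L2norm_sqrE f : L2norm P f ^+ 2 = \int[P]_w (f w ^+ 2).
Proof.
rewrite /L2norm sqr_sqrtr; first by rewrite unlock.
by apply: fine_ge0; apply: expectation_ge0 => w; exact: sqr_ge0.
Qed.

Lemma Lfun2P f : measurable_fun setT f -> ('E_P[f ^+ 2] < +oo)%E ->
  f \in Lfun P 2%:E.
Proof.
move=> mf; rewrite unlock => f2; apply/andP; split; first by rewrite inE.
rewrite inE/= /finite_norm unlock /Lnorm; apply: poweR_lty.
rewrite (_ : integral _ _ _ = \int[P]_w ((f ^+ 2) w)%:E)%E//.
by apply: eq_integral => w _ /=; rewrite powR_mulrn// real_normK ?num_real.
Qed.

Lemma Lfun2_sqr_integrable f : f \in Lfun P 2%:E ->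
  P.-integrable setT (EFin \o (fun w => f w ^+ 2)).
Proof. exact: Lfun2_integrable_sqr. Qed.

Lemma Lfun2_mul_integrable f g : f \in Lfun P 2%:E -> g \in Lfun P 2%:E ->
  P.-integrable setT (EFin \o (fun w => f w * g w)).
Proof. by move=> hf hg; apply/Lfun1_integrable; exact: Lfun2_mul_Lfun1. Qed.

Lemma LnormEL2norm f : f \in Lfun P 2%:E ->
  ('N[P]_2%:E[EFin \o f] = (L2norm P f)%:E)%E.
Proof.
move=> hf; rewrite unlock /Lnorm.
have hE : (\int[P]_x `|(EFin \o f) x| `^ 2 = (\int[P]_w (f w ^+ 2))%:E)%E.
  rewrite /Rintegral fineK; last first.
    by apply: integrable_fin_num => //; exact: Lfun2_sqr_integrable.
  by apply: eq_integral => w _ /=; rewrite powR_mulrn// real_normK ?num_real.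
rewrite hE poweR_EFin powR12_sqrt; last first.
  by rewrite -L2norm_sqrE sqr_ge0.
by rewrite -L2norm_sqrE sqrtr_sqr ger0_norm// sqrtr_ge0.
Qed.

Lemma Lfun2D f g : f \in Lfun P 2%:E -> g \in Lfun P 2%:E ->
  f \+ g \in Lfun P 2%:E.
Proof. by move=> hf hg; rewrite rpredD ?lee1n. Qed.

Lemma Lfun2B f g : f \in Lfun P 2%:E -> g \in Lfun P 2%:E ->
  f \- g \in Lfun P 2%:E.
Proof. by move=> hf hg; rewrite rpredB ?lee1n. Qed.

Lemma L2normD f g : f \in Lfun P 2%:E -> g \in Lfun P 2%:E ->
  L2norm P (f \+ g) <= L2norm P f + L2norm P g.
Proof.
move=> hf hg; rewrite -lee_fin EFinD.
have hfg : (f \+ g) \in Lfun P 2%:E by exact: Lfun2D.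
rewrite -!LnormEL2norm//; apply: minkowski_EFin.
- by move: hf => /andP[/[!inE]].
- by move: hg => /andP[/[!inE]].
- by rewrite ler1n.
Qed.

Lemma L2normC f g : L2norm P (f \- g) = L2norm P (g \- f).
Proof.
rewrite /L2norm; congr (Num.sqrt (fine 'E_P[_]%E)).
by apply/funext => w /=; rewrite !expr2 -mulrNN !opprB.
Qed.

Lemma L2norm_ge0 f : 0 <= L2norm P f.
Proof. exact: sqrtr_ge0. Qed.

(** By Minkowski's inequality. *)
Lemma L2norm_dist f g h : f \in Lfun P 2%:E -> g \in Lfun P 2%:E ->
  h \in Lfun P 2%:E ->
  `|L2norm P (f \- h) - L2norm P (g \- h)| <= L2norm P (f \- g).
Proof.
move=> hf hg hh.
have tri f1 f2 : f1 \in Lfun P 2%:E -> f2 \in Lfun P 2%:E ->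
    L2norm P (f1 \- h) <= L2norm P (f1 \- f2) + L2norm P (f2 \- h).
  move=> h1 h2; rewrite [in leLHS](_ : f1 \- h = (f1 \- f2) \+ (f2 \- h)).
    by apply: L2normD; exact: Lfun2B.
  by apply/funext => w /=; rewrite addrA subrK.
have h1 := tri f g hf hg; have h2 := tri g f hg hf.
rewrite [in L2norm P (g \- f) + _]L2normC in h2.
rewrite ler_norml; lra.
Qed.

Lemma integrable_bernoulli_mean n (s : 'rV[R]_n) (F : 'rV[R]_n -> Omega -> R) :
  (forall x, cube x -> P.-integrable setT (EFin \o F x)) ->
  P.-integrable setT (EFin \o (fun w => bernoulli_mean s (F ^~ w))) /\
  \int[P]_w bernoulli_mean s (F ^~ w) =
  bernoulli_mean s (fun x => \int[P]_w F x w).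
Proof.
move=> hF; have hFe (e : {ffun 'I_n -> bool}) (a : R) : P.-integrable setT
    (EFin \o (fun w => F (\row_i (e i)%:R) w * a)).
  by apply: (integrableZr measurableT a (hF _ (vertex_cube e))).
split; first by apply: integrable_sumEFin => // e; exact: hFe.
rewrite /bernoulli_mean Rintegral_sum//.
by apply: eq_bigr => e _; rewrite RintegralZr//; apply: hF; exact: vertex_cube.
Qed.

(** The mean square interpolation error depends on the field only through the
    mean squares of its increments. *)
Lemma L2norm_interpolation n (Y : 'rV[R]_n -> Omega -> R) (s : 'rV[R]_n) :
  (forall x, cube x -> Y x \in Lfun P 2%:E) -> cube s ->
  L2norm P (fun w => Y s w - bernoulli_mean s (Y ^~ w)) ^+ 2 =
  interp_error (fun a b => L2norm P (Y a \- Y b) ^+ 2) s.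
Proof.
move=> hY cs; rewrite L2norm_sqrE.
have hG a b : cube a -> cube b ->
    P.-integrable setT (EFin \o (fun w => (Y a w - Y b w) ^+ 2)).
  move=> ca cb; apply: (@Lfun2_sqr_integrable (Y a \- Y b)).
  by apply: Lfun2B; exact: hY.
under eq_Rintegral do rewrite (sqr_interpolation_error (Y ^~ _)).
rewrite /interp_error.
have [i1 e1] := @integrable_bernoulli_mean _ s
  (fun b w => (Y s w - Y b w) ^+ 2) (fun b cb => hG s b cs cb).
have in2 a (ca : cube a) := @integrable_bernoulli_mean _ s
  (fun b w => (Y a w - Y b w) ^+ 2) (fun b cb => hG a b ca cb).
have [i2 e2] := @integrable_bernoulli_mean _ s
  (fun a w => bernoulli_mean s (fun b => (Y a w - Y b w) ^+ 2))
  (fun a ca => (in2 a ca).1).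
rewrite RintegralB//; last exact: (integrableZl measurableT 2^-1 i2).
rewrite RintegralZl// e1 e2; congr (_ - _ * _).
  by apply: eq_bernoulli_mean => b _; rewrite L2norm_sqrE.
apply: eq_bernoulli_mean => a ca; rewrite (in2 a ca).2.
by apply: eq_bernoulli_mean => b _; rewrite L2norm_sqrE.
Qed.

End second_moments.

(** * Interpolation of fractional Brownian fields *)

Section fractional_brownian.
Context {R : realType}.

(** The integrand of the constant [b], written with the increments of the
    field only; see [fbf_interp_errorE]. *)
Definition fbf_interp_error (beta : R) m (u s : 'rV[R]_m) : R :=
  interp_error (fun x y => euclid_norm (cmul u (x - y)) `^ beta) s.

Lemma euclid_norm0 m : euclid_norm (0 : 'rV[R]_m) = 0.
Proof.
by rewrite /euclid_norm big1 ?sqrtr0// => i _; rewrite mxE expr0n.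
Qed.

Section covariance.
Context (beta : R) m (B : fractional_brownian_field beta m).
Local Notation P := (fbf_prob B).

Let fbfE t s : orthant t -> orthant s ->
  'E_P[(B t : _ -> R) * (B s : _ -> R)]%E =
  (2^-1 * (euclid_norm t `^ beta + euclid_norm s `^ beta
           - euclid_norm (t - s) `^ beta))%:E.
Proof.
move=> ht hs; rewrite -(fbf_covariance B ht hs) covariance.unlock.
rewrite !fbf_mean//=; congr ('E_P[_])%E; apply/funext => w /=.
by rewrite !fctE/= !subr0.
Qed.

Lemma fbf_Lfun2 t : orthant t -> (B t : _ -> R) \in Lfun P 2%:E.
Proof.
move=> ht; apply: Lfun2P; first exact: measurable_funP.
by rewrite expr2 fbfE// ltry.
Qed.

Lemma fbf_increment t s : beta != 0 -> orthant t -> orthant s ->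
  L2norm P (B t \- B s) ^+ 2 = euclid_norm (t - s) `^ beta.
Proof.
move=> b0 ht hs; rewrite L2norm_sqrE.
have hI a b : orthant a -> orthant b ->
    P.-integrable setT (EFin \o (fun w => B a w * B b w)).
  by move=> ha hb; apply: Lfun2_mul_integrable; exact: fbf_Lfun2.
have hE a b : orthant a -> orthant b -> \int[P]_w (B a w * B b w) =
    2^-1 * (euclid_norm a `^ beta + euclid_norm b `^ beta
             - euclid_norm (a - b) `^ beta).
  by move=> ha hb; have := fbfE ha hb; rewrite unlock => h; rewrite /Rintegral h.
transitivity (\int[P]_w (B t w * B t w + B s w * B s w - 2 * (B t w * B s w))).
  by apply: eq_Rintegral => w _ /=; ring.
rewrite RintegralB//; last 2 first.
- exact: (integrableD measurableT (hI t t ht ht) (hI s s hs hs)).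
- exact: (integrableZl measurableT 2 (hI t s ht hs)).
rewrite RintegralD ?RintegralZl//; [|exact: hI..].
have d0 a : euclid_norm (a - a) `^ beta = 0 by rewrite subrr euclid_norm0 powR0.
rewrite (hE t t ht ht) (hE s s hs hs) (hE t s ht hs) !d0.
move: (euclid_norm t `^ beta) (euclid_norm s `^ beta) => p q.
by move: (euclid_norm (t - s) `^ beta) => r; field.
Qed.

Lemma fbf_interp_errorE (u s : 'rV[R]_m) : beta != 0 -> orthant u -> cube s ->
  L2norm P (fun w => B (cmul u s) w - bernoulli_mean s (fun x => B (cmul u x) w))
    ^+ 2 = fbf_interp_error beta u s.
Proof.
move=> b0 hu cs.
have hux x : cube x -> orthant (cmul u x).
  by move=> cx i; rewrite mxE mulr_ge0//; have /andP[] := cx i.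
rewrite (@L2norm_interpolation _ _ _ P _ (fun x => B (cmul u x)))//; last first.
  by move=> x cx; apply: fbf_Lfun2; exact: hux.
apply: eq_interp_error => // x y cx cy.
rewrite (fbf_increment b0 (hux x cx) (hux y cy)).
have -> // : cmul u x - cmul u y = cmul u (x - y).
by apply/rowP => i; rewrite !mxE mulrBr.
Qed.

Lemma b_constE (u : 'rV[R]_m) : beta != 0 -> orthant u ->
  b_const B u = cube_integral (fbf_interp_error beta u).
Proof.
by move=> b0 hu; apply: eq_cube_integral => s cs; exact: fbf_interp_errorE.
Qed.

Lemma fbf_interp_error_ge0 (u s : 'rV[R]_m) : beta != 0 -> orthant u -> cube s ->
  0 <= fbf_interp_error beta u s.
Proof. by move=> b0 hu cs; rewrite -fbf_interp_errorE// sqr_ge0. Qed.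

End covariance.
End fractional_brownian.

Section fbf_interp_error_theory.
Context {R : realType}.

(** Each of the fractions [x / (x + y)] and [y / (x + y)] is at most its
    [p]-th power, and they sum to 1. *)
Lemma powR_subadd (p x y : R) : 0 < p <= 1 -> 0 <= x -> 0 <= y ->
  (x + y) `^ p <= x `^ p + y `^ p.
Proof.
move=> /andP[p0 p1]; rewrite le_eqVlt => /predU1P[<- _|x0].
  by rewrite powR0 ?gt_eqF// !add0r.
rewrite le_eqVlt => /predU1P[<-|y0].
  by rewrite powR0 ?gt_eqF// !addr0.
have s0 : 0 < x + y by rewrite addr_gt0.
have frac (z : R) : 0 < z -> z <= x + y -> z / (x + y) * (x + y) `^ p <= z `^ p.
  move=> z0 zs; rewrite -[in leRHS](divfK (lt0r_neq0 s0) z).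
  rewrite powRM; [|by rewrite divr_ge0// ltW|exact: ltW].
  apply: ler_wpM2r; first exact: powR_ge0.
  by apply: ger1_powR => //; rewrite divr_gt0//= ler_pdivrMr// mul1r.
apply: le_trans (lerD (frac x x0 _) (frac y y0 _)).
- by rewrite -mulrDl -mulrDl divff ?gt_eqF// mul1r.
- by rewrite lerDl ltW.
- by rewrite lerDr ltW.
Qed.

Lemma powR_dist (p x y : R) : 0 < p <= 1 -> 0 <= x -> 0 <= y ->
  `|x `^ p - y `^ p| <= `|x - y| `^ p.
Proof.
move=> p01; wlog xy : x y / y <= x => [hw|] x0 y0.
  have [/hw|/ltW/hw] := leP y x; first exact.
  by move=> h; rewrite distrC [in leRHS]distrC; exact: h.
have p0 : 0 <= p by case/andP: p01 => /ltW.
rewrite [in leRHS]ger0_norm ?subr_ge0// ger0_norm; last first.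
  by rewrite subr_ge0; apply: ge0_ler_powR; rewrite ?nnegrE.
rewrite lerBlDr -[in leLHS](subrK y x).
by apply: powR_subadd => //; rewrite subr_ge0.
Qed.

Lemma euclid_norm_ge0 m (v : 'rV[R]_m) : 0 <= euclid_norm v.
Proof. exact: sqrtr_ge0. Qed.

Lemma euclid_norm_powR m (v : 'rV[R]_m) (a : R) :
  euclid_norm v `^ a = (\sum_i v 0 i ^+ 2) `^ (a / 2).
Proof.
have s0 : 0 <= \sum_i v 0 i ^+ 2 by apply: sumr_ge0 => i _; exact: sqr_ge0.
by rewrite /euclid_norm -powR12_sqrt// -powRrM mulrC.
Qed.

Lemma euclid_normZ m (a : R) (v : 'rV[R]_m) : 0 <= a ->
  euclid_norm (a *: v) = a * euclid_norm v.
Proof.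
move=> a0; rewrite /euclid_norm; under eq_bigr do rewrite mxE exprMn.
by rewrite -mulr_sumr sqrtrM ?sqr_ge0// sqrtr_sqr ger0_norm.
Qed.

Lemma euclid_norm_le m (v : 'rV[R]_m) (a : R) : 0 <= a ->
  (forall i, `|v 0 i| <= a) -> euclid_norm v <= Num.sqrt m%:R * a.
Proof.
move=> a0 va; rewrite -[X in _ * X]ger0_norm// -sqrtr_sqr -sqrtrM ?ler0n//.
rewrite /euclid_norm ler_wsqrtr//.
apply: le_trans (_ : \sum_(i < m) a ^+ 2 <= _); last first.
  by rewrite sumr_const card_ord mulr_natl.
apply: ler_sum => i _; rewrite -real_normK ?num_real//.
by rewrite ler_sqr ?nnegrE//; exact: va.
Qed.

(** [|v| ^ a] is the power [a / 2 < 1] of a sum of squares, and such a power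
    is Hoelder continuous by [powR_dist].  The modulus is uniform over bounded
    sets, in particular up to the origin, where [|v| ^ a] need not be
    differentiable. *)
Lemma euclid_norm_powR_modulus (a : R) m (K e : R) : 0 < a < 2 -> 0 <= K ->
  0 < e -> exists2 delta, 0 < delta & forall v w : 'rV[R]_m,
    (forall i, `|v 0 i| <= K) -> (forall i, `|w 0 i| <= K) ->
    (forall i, `|v 0 i - w 0 i| <= delta) ->
    `|euclid_norm v `^ a - euclid_norm w `^ a| <= e.
Proof.
move=> /andP[a0 a2] K0 e0.
have p01 : 0 < a / 2 <= 1.
  by rewrite divr_gt0//= ler_pdivrMr// mul1r ltW.
have p0 : 0 <= a / 2 by rewrite divr_ge0// ltW.
have D0 : 0 < 2 * m%:R * K + 1.
  by rewrite ltr_wpDl// !mulr_ge0.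
(* the sums of squares differ by at most [2 * m * K * delta]; the [+ 1] avoids a
   division by zero *)
exists (e `^ (a / 2)^-1 / (2 * m%:R * K + 1)) => [|v w vK wK vw].
  by rewrite divr_gt0// powR_gt0.
rewrite !euclid_norm_powR; apply: le_trans (powR_dist _ _ _) _ => //.
- by apply: sumr_ge0 => i _; exact: sqr_ge0.
- by apply: sumr_ge0 => i _; exact: sqr_ge0.
have -> : e = (e `^ (a / 2)^-1) `^ (a / 2).
  rewrite -powRrM mulVf ?powRr1//; first exact: ltW.
  by case/andP: p01 => /lt0r_neq0.
apply: ge0_ler_powR; rewrite ?nnegrE ?normr_ge0 ?powR_ge0//.
rewrite -sumrB; apply: le_trans (ler_norm_sum _ _ _) _.
set delta := _ / _ in vw *.
have d0 : 0 <= delta by rewrite divr_ge0 ?powR_ge0// ltW.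
apply: (@le_trans _ _ (\sum_(i < m) (2 * K * delta))).
  apply: ler_sum => i _; rewrite subr_sqr normrM mulrC; apply: ler_pM => //.
  apply: le_trans (ler_normD _ _) _.
  by rewrite mulr_natl mulr2n lerD.
rewrite sumr_const card_ord -[_ *+ m]mulr_natl.
have -> : m%:R * (2 * K * delta) = (2 * m%:R * K) * delta by ring.
rewrite /delta mulrCA ler_piMr ?powR_ge0// ler_pdivrMr// mul1r.
by rewrite lerDl.
Qed.

Lemma cube_coord_dist m (x y : 'rV[R]_m) i :
  cube x -> cube y -> `|x 0 i - y 0 i| <= 1.
Proof.
move=> cx cy; have /andP[x0 x1] := cx i; have /andP[y0 y1] := cy i.
by rewrite ler_norml; apply/andP; split; lra.
Qed.

Section block.
Context (a : R) (m : nat).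
Hypothesis a02 : 0 < a < 2.
Local Notation Q := (fbf_interp_error a).
Implicit Types u s : 'rV[R]_m.

Let a_neq0 : a != 0. Proof. by case/andP: a02 => /lt0r_neq0. Qed.

Lemma fbf_interp_error_modulus K e : 0 <= K -> 0 < e ->
  exists2 delta, 0 < delta & forall u u',
    (forall i, `|u 0 i| <= K) -> (forall i, `|u' 0 i| <= K) ->
    (forall i, `|u 0 i - u' 0 i| <= delta) ->
    forall s, cube s -> `|Q u s - Q u' s| <= e.
Proof.
move=> K0 e0; have e20 : 0 < 2 / 3 * e by rewrite mulr_gt0// divr_gt0.
have [delta d0 hd] := euclid_norm_powR_modulus m a02 K0 e20.
exists delta => // u u' uK u'K uu' s cs.
have -> : e = 3 / 2 * (2 / 3 * e) by field.
apply: interp_error_dist => // x y cx cy.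
apply: hd => i; rewrite !mxE.
- by rewrite normrM -[K]mulr1 ler_pM//; exact: cube_coord_dist.
- by rewrite normrM -[K]mulr1 ler_pM//; exact: cube_coord_dist.
- by rewrite -mulrBl normrM -[delta]mulr1 ler_pM//; exact: cube_coord_dist.
Qed.

Lemma fbf_interp_error_continuous u : cube_continuous (Q u).
Proof.
apply: cube_continuous_interp => y cy; apply/cube_continuousP => t ct e e0.
pose K := \sum_i `|u 0 i|.
have uK i : `|u 0 i| <= K.
  by rewrite /K (bigD1 i)//= lerDl; apply: sumr_ge0.
have K0 : 0 <= K by apply: sumr_ge0.
have e20 : 0 < e / 2 by rewrite divr_gt0.
have [delta d0 hd] := euclid_norm_powR_modulus m a02 K0 e20.
have K10 : 0 < K + 1 by rewrite ltr_wpDl.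
exists (delta / (K + 1)); first by rewrite divr_gt0.
move=> s cs st; apply: le_lt_trans (_ : e / 2 < e); last first.
  by rewrite ltr_pdivrMr// ltr_pMr// ltr1n.
apply: hd => i; rewrite !mxE.
- by rewrite normrM -[K]mulr1 ler_pM//; exact: cube_coord_dist.
- by rewrite normrM -[K]mulr1 ler_pM//; exact: cube_coord_dist.
rewrite -mulrBr opprB addrA subrK normrM.
have := ltW (st i); rewrite ler_pdivlMr// mulrC => h.
by apply: le_trans h; rewrite ler_wpM2r// (le_trans (uK i))// lerDl.
Qed.

(** At the midpoint of an edge the interpolant is the average of the values at
    the two ends, and the error is the variance of a fractional Brownian bridge
    at half time. *)
Lemma fbf_interp_error_gt0 u : (0 < m)%N -> (forall i, 0 < u 0 i) ->
  exists2 s, cube s & 0 < Q u s.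
Proof.
move=> m0 u0; pose i0 := Ordinal m0.
pose pt (r : R) : 'rV[R]_m := \row_i (if i == i0 then r else 0).
have ptcube r : 0 <= r <= 1 -> cube (pt r).
  by move=> r01 i; rewrite mxE; case: eqP => // _; rewrite lexx ler01.
have h01 : 0 <= (2^-1 : R) <= 1.
  by rewrite invr_ge0 ler0n invf_le1// ler1n.
exists (pt 2^-1); first exact: ptcube.
have meanE f : bernoulli_mean (pt 2^-1) f = 2^-1 * f (pt 0) + 2^-1 * f (pt 1).
  (* only two vertices have a nonzero weight *)
  pose e0 : {ffun 'I_m -> bool} := [ffun=> false].
  pose e1 : {ffun 'I_m -> bool} := [ffun i => i == i0].
  have e10 : e1 != e0.
    by apply/eqP => /ffunP/(_ i0); rewrite !ffunE eqxx.
  rewrite /bernoulli_mean (bigD1 e0)//= (bigD1 e1)//= [X in _ + (_ + X)]big1.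
    rewrite addr0; congr (_ + _).
      rewrite mulrC (bigD1 i0)//= big1 ?mulr1 => [|i /negbTE ii0].
        rewrite !mxE !ffunE eqxx expr0 mul1r expr1; congr (_ * _).
          by field.
        by congr f; apply/rowP => i; rewrite !mxE !ffunE if_same.
      by rewrite !mxE !ffunE ii0 expr0 mul1r expr1 subr0.
    rewrite mulrC (bigD1 i0)//= big1 ?mulr1 => [|i /negbTE ii0].
      rewrite !mxE !ffunE eqxx expr0 mulr1 expr1; congr (_ * f _).
      by apply/rowP => i; rewrite !mxE !ffunE; case: eqP.
    by rewrite !mxE !ffunE ii0 expr0 mul1r expr1 subr0.
  move=> e /andP[ee0 ee1].
  have [i /andP[ii0 ei]] : exists i, (i != i0) && e i.
    apply/existsP; apply: contraT => /existsPn ne.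
    have eE i : i != i0 -> e i = false.
      by move=> ii0; have := ne i; rewrite ii0/= => /negbTE.
    case ei0 : (e i0).
      case/negP: ee1; apply/eqP/ffunP => i; rewrite ffunE.
      by have [->|/eE] := eqVneq i i0.
    case/negP: ee0; apply/eqP/ffunP => i; rewrite ffunE.
    by have [->|/eE] := eqVneq i i0.
  by rewrite (bigD1 i)//= ei !mxE (negbTE ii0) expr1 !mul0r mulr0.
have normE r r' : euclid_norm (cmul u (pt r - pt r')) = u 0 i0 * `|r - r'|.
  rewrite /euclid_norm (bigD1 i0)//= big1 => [|i /negbTE ii0].
    rewrite addr0 !mxE eqxx sqrtr_sqr normrM ger0_norm//.
    by rewrite ltW.
  by rewrite !mxE ii0 subrr mulr0 expr0n.
have /andP[a0 a2] := a02.
have half : `|2^-1 - 1| = 2^-1 :> R by rewrite ler0_norm; lra.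
have half' : `|2^-1| = 2^-1 :> R by rewrite ger0_norm; case/andP: h01.
pose g (x y : 'rV[R]_m) := euclid_norm (cmul u (x - y)) `^ a.
have gE r r' : g (pt r) (pt r') = u 0 i0 `^ a * `|r - r'| `^ a.
  by rewrite /g normE powRM// ltW.
rewrite /fbf_interp_error -/g; move: g gE => g gE.
rewrite /interp_error (meanE (g _)) (meanE (fun x => bernoulli_mean _ (g x))).
rewrite (meanE (g (pt 0))) (meanE (g (pt 1))) !gE.
rewrite subr0 !subrr sub0r subr0 normrN1 normr1 normr0 powR1 powR0// half half'.
have U0 : 0 < u 0 i0 `^ a by rewrite powR_gt0.
(* [(1/2) ^ a > (1/2) ^ 2] because [a < 2] *)
have H : 2^-1 * 2^-1 < 2^-1 `^ a :> R.
  have -> : 2^-1 * 2^-1 = 2^-1 `^ a * 2^-1 `^ (2 - a) :> R.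
    rewrite -powRD; last by rewrite invr_neq0 ?implybT.
    by rewrite addrC subrK powR_mulrn.
  rewrite -[ltRHS]mulr1 ltr_pM2l; last by rewrite powR_gt0.
  have : 2^-1 `^ (2 - a) < 1 `^ (2 - a) :> R; last by rewrite powR1.
  apply: gt0_ltr_powR.
  - by rewrite subr_gt0.
  - by rewrite nnegrE.
  - by rewrite nnegrE.
  - by rewrite invf_lt1// ltr1n.
have := mulr_gt0 U0 (_ : 0 < 2^-1 `^ a - 2^-1 * 2^-1).
rewrite subr_gt0 => /(_ H); lra.
Qed.

End block.
End fbf_interp_error_theory.

Section b_const_theory.
Context {R : realType} (a : R) (m : nat) (B : fractional_brownian_field a m).
Hypothesis a02 : 0 < a < 2.
Implicit Types u s : 'rV[R]_m.

Let a_neq0 : a != 0. Proof. by case/andP: a02 => /lt0r_neq0. Qed.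

Lemma b_const_modulus K e : 0 <= K -> 0 < e ->
  exists2 delta, 0 < delta & forall u u',
    (forall i, 0 <= u 0 i <= K) -> (forall i, 0 <= u' 0 i <= K) ->
    (forall i, `|u 0 i - u' 0 i| <= delta) ->
    `|b_const B u - b_const B u'| <= e.
Proof.
move=> K0 e0; have [delta d0 hd] := @fbf_interp_error_modulus R a m a02 K e K0 e0.
exists delta => // u u' uK u'K uu'.
rewrite !b_constE//; [|by move=> i; have /andP[] := u'K i
  |by move=> i; have /andP[] := uK i].
apply: cube_integral_dist.
- by apply: cube_continuous_integrand; exact: fbf_interp_error_continuous.
- by apply: cube_continuous_integrand; exact: fbf_interp_error_continuous.
apply: hd => // i; first by have /andP[? ?] := uK i; rewrite ger0_norm.
by have /andP[? ?] := u'K i; rewrite ger0_norm.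
Qed.

Lemma b_const_ge0 u : 0 <= b_const B u.
Proof. by apply: cube_integral_ge0 => s _; exact: sqr_ge0. Qed.

Lemma b_const_gt0 u : (0 < m)%N -> (forall i, 0 < u 0 i) -> 0 < b_const B u.
Proof.
move=> m0 u0; have hu : orthant u by move=> i; exact: ltW.
rewrite b_constE//.
have [s cs Qs] := fbf_interp_error_gt0 a02 m0 u0.
apply: cube_integral_gt0 cs Qs; first exact: fbf_interp_error_continuous.
by move=> t ct; exact: fbf_interp_error_ge0.
Qed.

End b_const_theory.

(** * Regular sequences of knots *)

Section design.
Context {R : realType}.
Local Notation mu := (@lebesgue_measure R).

Lemma cube_continuous_comp_coord n (m : 'I_n) (h : R -> R) :
  {within `[0, 1], continuous h} -> cube_continuous (fun t : 'rV[R]_n => h (t 0 m)).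
Proof.
move=> /subspace_continuousP ch; apply/cube_continuousP => t ct e e0.
have t01 : `[0, 1]%classic (t 0 m) by rewrite /= in_itv/=; exact: ct.
have /cvgrPdist_lt/(_ e e0) := ch _ t01.
rewrite near_withinE => /nbhs_ballP[d /= d0 hd]; exists d => // s cs st.
rewrite distrC; apply: hd; last by rewrite /= in_itv/=; exact: cs.
by rewrite /ball/= distrC; exact: st.
Qed.

Section density.
Context (h : R -> R).
Hypothesis hh : design_density h.

Let h_cont : {within `[0, 1], continuous h}. Proof. by case: hh. Qed.

Lemma design_density_lb : exists2 c : R, 0 < c &
  forall x, 0 <= x <= 1 -> c <= h x.
Proof.
have [c c01 hc] := EVT_min (@ler01 R) h_cont.
exists (h c).
  by move: c01; rewrite in_itv/=; case: hh => _ + _; exact.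
by move=> x x01; apply: hc; rewrite in_itv.
Qed.

Lemma design_density_unif e : 0 < e -> exists2 d : R, 0 < d &
  forall x y, 0 <= x <= 1 -> 0 <= y <= 1 -> `|x - y| < d -> `|h x - h y| < e.
Proof.
move=> e0.
have [d d0 hd] :=
  cube_unif_continuous (@cube_continuous_comp_coord 1 ord0 h h_cont) e0.
exists d => // x y x01 y01 xy.
have := hd (\row__ x) (\row__ y); rewrite !mxE; apply=> i; rewrite !mxE//.
Qed.

Let h_int : mu.-integrable `[0, 1] (EFin \o h).
Proof.
by apply: continuous_compact_integrable => //; exact: segment_compact.
Qed.

Lemma design_integral_bounds (x y lo hi : R) : 0 <= x -> x <= y -> y <= 1 ->
  (forall v, x <= v <= y -> lo <= h v <= hi) ->
  lo * (y - x) <=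
  \int[mu]_(v in `[0, y]) h v - \int[mu]_(v in `[0, x]) h v <= hi * (y - x).
Proof.
move=> x0 xy y1 lohi.
have int0y : mu.-integrable `[0, y] (EFin \o h).
  apply: integrableS h_int => //; apply: subset_itvl.
  by rewrite bnd_simp.
rewrite Rintegral_itvB//; [|by rewrite bnd_simp..].
have intxy : mu.-integrable `]x, y] (EFin \o h).
  by apply: integrableS int0y => //; apply: subset_itvr; rewrite bnd_simp.
have muE : mu `]x, y]%classic = (y - x)%:E.
  rewrite lebesgue_measure_itv/= lte_fin.
  by move: xy; rewrite le_eqVlt => /predU1P[->|->//]; rewrite ltxx subrr.
have mufin : (mu `]x, y]%classic < +oo)%E by rewrite muE ltry.
have intc (r : R) : mu.-integrable `]x, y] (EFin \o cst r).
  apply: measurable_bounded_integrable => //.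
  exists `|r|; split; first exact: num_real.
  by move=> z rz w _ /=; exact: ltW.
have cstE (r : R) : \int[mu]_(v in `]x, y]) cst r v = r * (y - x).
  by rewrite Rintegral_cst// [X in fine X](_ : _ = (y - x)%:E).
rewrite -!cstE; apply/andP; split; apply: le_Rintegral => //.
- move=> v /=; rewrite in_itv/= => /andP[/ltW xv vy].
  by case/andP: (lohi v (introT andP (conj xv vy))).
- move=> v /=; rewrite in_itv/= => /andP[/ltW xv vy].
  by case/andP: (lohi v (introT andP (conj xv vy))).
Qed.

Section knots.
Context (n : nat) (t : nat -> R).
Hypothesis n0 : (0 < n)%N.
Hypothesis ht : forall i, (i <= n)%N ->
  0 <= t i <= 1 /\ \int[mu]_(v in `[0, t i]) h v = i%:R / n%:R.

Let nR0 : 0 < n%:R :> R. Proof. by rewrite ltr0n. Qed.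

Lemma knot_lt i : (i < n)%N -> t i < t i.+1.
Proof.
move=> iN; have [/andP[t0 t1] ti] := ht (ltnW iN).
have [/andP[s0 s1] si] := ht iN.
rewrite ltNge; apply/negP => st.
have [M hM] : exists M, forall v, t i.+1 <= v <= t i -> 0 <= h v <= M.
  have [c _ hc] := EVT_max (@ler01 R) h_cont.
  exists (h c) => v /andP[v0 v1].
  have v01 : 0 <= v <= 1 by rewrite (le_trans s0 v0) (le_trans v1 t1).
  rewrite hc ?in_itv// andbT; have [d d0 hd] := design_density_lb.
  exact: le_trans (ltW d0) (hd v v01).
have /andP[+ _] := design_integral_bounds s0 st t1 hM.
rewrite mul0r ti si -mulrBl pmulr_lge0 ?invr_gt0// subr_ge0 ler_nat.
by rewrite ltnn.
Qed.

Lemma knot0 : t 0 = 0.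
Proof.
have [/andP[t0 t1] ti] := ht (leq0n n).
have [c c0 hc] := design_density_lb.
have [d _ hd] := EVT_max (@ler01 R) h_cont.
have hM v : 0 <= v <= t 0%N -> c <= h v <= h d.
  move=> /andP[v0 v1]; rewrite hc ?hd ?in_itv//= ?v0 ?(le_trans v1)//.
have /andP[+ _] := design_integral_bounds (lexx 0) t0 t1 hM.
rewrite ti mul0r set_itv1 Rintegral_set1 !subr0 pmulr_rle0// => h0.
by apply/le_anti; rewrite h0 t0.
Qed.

Lemma knotn : t n = 1.
Proof.
have [/andP[t0 t1] ti] := ht (leqnn n).
have [c c0 hc] := design_density_lb.
have [d _ hd] := EVT_max (@ler01 R) h_cont.
have hM v : t n <= v <= 1 -> c <= h v <= h d.
  by move=> /andP[v0 v1]; rewrite hc ?hd ?in_itv//= ?v1 ?andbT ?(le_trans t0 v0).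
have /andP[+ _] := design_integral_bounds t0 t1 (lexx 1) hM.
have -> : \int[mu]_(v in `[0, 1]) h v = 1 by case: hh.
rewrite ti divff ?gt_eqF// subrr pmulr_rle0// subr_le0 => h0.
by apply/le_anti; rewrite h0 t1.
Qed.

Lemma knot_step_le c i : 0 < c -> (forall x, 0 <= x <= 1 -> c <= h x) ->
  (i < n)%N -> n%:R * (t i.+1 - t i) <= c^-1.
Proof.
move=> c0 hc iN; have [/andP[t0 t1] ti] := ht (ltnW iN).
have [/andP[s0 s1] si] := ht iN; have /ltW ts := knot_lt iN.
have [d _ hd] := EVT_max (@ler01 R) h_cont.
have hM v : t i <= v <= t i.+1 -> c <= h v <= h d.
  move=> /andP[v0 v1]; have v01 : 0 <= v <= 1.
    by rewrite (le_trans t0 v0) (le_trans v1 s1).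
  by rewrite hc// hd// in_itv.
have /andP[+ _] := design_integral_bounds t0 ts s1 hM.
rewrite ti si -mulrBl -natr1 addrAC subrr add0r mul1r => hle.
rewrite -[leRHS]mulr1 -ler_pdivrMl ?invr_gt0// invrK mulrCA.
by rewrite -ler_pdivlMl// mulr1.
Qed.

(** By the mean value theorem [n (t_{i+1} - t_i)] is the inverse of a value of
    [h] in the [i]-th interval. *)
Lemma knot_step_dist c d e i : 0 < c -> (forall x, 0 <= x <= 1 -> c <= h x) ->
  (forall x y, 0 <= x <= 1 -> 0 <= y <= 1 -> `|x - y| < d ->
    `|h x - h y| < e * c ^+ 2) ->
  (i < n)%N -> t i.+1 - t i < d ->
  `|n%:R * (t i.+1 - t i) - (h (t i))^-1| <= e.
Proof.
move=> c0 hc hd iN td; have [/andP[t0 t1] ti] := ht (ltnW iN).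
have [/andP[s0 s1] si] := ht iN; have /ltW ts := knot_lt iN.
have t01 : 0 <= t i <= 1 by rewrite t0.
set r := t i.+1 - t i; have r0 : 0 <= r by rewrite subr_ge0.
have hM v : t i <= v <= t i.+1 ->
    h (t i) - e * c ^+ 2 <= h v <= h (t i) + e * c ^+ 2.
  move=> /andP[v0 v1]; rewrite -ler_distl ltW// hd//.
    by rewrite (le_trans t0 v0) (le_trans v1 s1).
  by rewrite ger0_norm ?subr_ge0//; apply: le_lt_trans td; rewrite lerB.
have := design_integral_bounds t0 ts s1 hM.
rewrite ti si -mulrBl -natr1 addrAC subrr add0r mul1r -/r => /andP[h1 h2].
have hrn := knot_step_le c0 hc iN; rewrite -/r in hrn.
have hc1 := hc _ t01; have hi0 : 0 < h (t i) by exact: lt_le_trans hc1.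
have e0 : 0 < e * c ^+ 2.
  apply: le_lt_trans (hd (t i) (t i) t01 t01 _) => //.
  by rewrite subrr normr0; apply: le_lt_trans td.
have -> : n%:R * r - (h (t i))^-1 = n%:R * (h (t i) * r - n%:R^-1) / h (t i).
  by field; rewrite !gt_eqF.
rewrite normrM normrM (ger0_norm (ltW nR0)) normfV (gtr0_norm hi0).
rewrite ler_pdivrMr//.
have hdist : `|h (t i) * r - n%:R^-1| <= e * c ^+ 2 * r.
  rewrite ler_distl; apply/andP; split; lra.
apply: le_trans (ler_wpM2l (ltW nR0) hdist) _.
have -> : n%:R * (e * c ^+ 2 * r) = e * c ^+ 2 * (n%:R * r) by ring.
apply: le_trans (ler_wpM2l (ltW e0) hrn) _.
have -> : e * c ^+ 2 / c = e * c by field; rewrite gt_eqF.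
apply: ler_wpM2l => //; rewrite -(pmulr_lge0 _ (exprn_gt0 2 c0)).
exact: ltW.
Qed.

Lemma knot_cover x : 0 <= x <= 1 ->
  exists2 i, (i < n)%N & t i <= x <= t i.+1.
Proof.
move=> /andP[x0 x1]; rewrite -knot0 in x0; rewrite -knotn in x1.
have cover p : (0 < p)%N -> x <= t p -> exists2 i, (i < p)%N & t i <= x <= t i.+1.
  elim: p => // p IH _ xp; have [p0|p_gt0] := posnP p.
    by exists 0%N; rewrite // x0 -p0.
  have [/(IH p_gt0)[i ip ix]|/ltW px] := leP x (t p).
    by exists i => //; exact: ltnW.
  by exists p => //; rewrite px.
exact: cover.
Qed.

End knots.
End density.
End design.

(** * Cells of the grid *)

Section finite_families.
Context {R : realType}.

(** A common radius for finitely many properties, each of which survives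
    shrinking its radius. *)
Lemma fin_common_bound (I : finType) (Q : I -> R -> Prop) :
  (forall i, exists2 d : R, 0 < d & Q i d) ->
  (forall i d d', 0 < d' -> d' <= d -> Q i d -> Q i d') ->
  exists2 d : R, 0 < d & forall i, Q i d.
Proof.
move=> hQ Qle.
have /choice[f hf] : forall i, exists d, 0 < d /\ Q i d.
  by move=> i; have [d ? ?] := hQ i; exists d.
have s0 : 0 < \sum_i (f i)^-1 + 1.
  by rewrite ltr_wpDl// sumr_ge0// => i _; rewrite invr_ge0 ltW// (hf i).1.
(* the inverse of the sum of the inverses is below each of the [f i]; the [+ 1]
   covers an empty family *)
exists (\sum_i (f i)^-1 + 1)^-1; first by rewrite invr_gt0.
move=> i; apply: Qle (hf i).2; first by rewrite invr_gt0.
rewrite invf_ple ?posrE//; last exact: (hf i).1.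
rewrite (bigD1 i)//= -addrA lerDl addr_ge0// sumr_ge0// => j _.
by rewrite invr_ge0 ltW// (hf j).1.
Qed.

(** Pieced together from integrands on finitely many affine cells that cover
    the cube. *)
Lemma cube_integrand_cells n (I : finType) (p r : I -> 'rV[R]_n)
    (f : 'rV[R]_n -> R) (g : I -> 'rV[R]_n -> R) :
  (forall i m, 0 < r i 0 m) ->
  (forall t, cube t -> exists i, exists2 s, cube s & t = p i + cmul (r i) s) ->
  (forall i s, cube s -> f (p i + cmul (r i) s) = g i s) ->
  (forall i, cube_integrand (g i)) -> cube_integrand f.
Proof.
move=> r0 cover fg hg; split; last first.
  have /choice[M hM] : forall i, exists M, forall t, cube t -> `|g i t| <= M.
    by move=> i; case: (hg i).
  exists (\sum_i `|M i|) => t /cover[i [s cs ->]]; rewrite fg//.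
  apply: le_trans (hM i s cs) _; apply: le_trans (ler_norm _) _.
  by rewrite (bigD1 i)//= lerDl sumr_ge0.
(* the inverse of the [i]-th affine map, clamped so that it maps into the cube *)
pose psi i (t : 'rV[R]_n) : 'rV[R]_n :=
  \row_m Num.max 0 (Num.min 1 ((t 0 m - p i 0 m) / r i 0 m)).
have psi_map i : cube_map (psi i).
  split=> [m|t ct m]; last first.
    by rewrite mxE le_max lexx/= ge_max ler01/= ge_min lexx.
  apply: (eq_measurable_fun (fun x => Num.max (cst 0 x)
      (Num.min (cst 1 x) ((row_of_tuple x 0 m - p i 0 m) * (r i 0 m)^-1)))).
    by move=> x _; rewrite /cst [RHS]mxE.
  apply: measurable_maxr; first exact: measurable_cst.
  apply: measurable_minr; first exact: measurable_cst.
  apply: measurable_funM; last exact: measurable_cst.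
  by apply: measurable_funB; [exact: measurable_coord|exact: measurable_cst].
pose J i m : interval R := `[p i 0 m, p i 0 m + r i 0 m].
pose C i := @row_of_tuple R n @^-1` cube `&`
  [set x | forall m, row_of_tuple x 0 m \in J i m].
apply: (@measurable_fun_fin_cover _ _ _ _ _ _ C).
- by move=> i; exact: measurable_box_coord.
- by move=> i x [].
- move=> x cx; have [i [s cs xE]] := cover _ cx; exists i; split=> //= m.
  rewrite xE !mxE in_itv/=; have /andP[s0 s1] := cs m.
  rewrite lerDl lerD2l; have ri := ltW (r0 i m).
  by rewrite mulr_ge0//= ler_piMr.
- move=> i; apply: (eq_measurable_fun ((g i \o psi i) \o @row_of_tuple R n)).
    move=> x /[!inE] -[cx xJ]; rewrite /= -fg; last exact: (psi_map i).2.
    congr f; apply/rowP => m; rewrite [LHS]mxE [X in _ + X]mxE [X in _ * X]mxE.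
    have := xJ m; rewrite in_itv/= => /andP[h1 h2].
    have h3 : 0 <= (row_of_tuple x 0 m - p i 0 m) / r i 0 m.
      by rewrite divr_ge0 ?subr_ge0// ltW.
    have h4 : (row_of_tuple x 0 m - p i 0 m) / r i 0 m <= 1.
      by rewrite ler_pdivrMr// mul1r lerBlDl.
    rewrite min_r// max_r// mulrC divfK; last by rewrite gt_eqF.
    by rewrite addrC subrK.
  have [mg _] := cube_integrand_comp (psi_map i) (hg i).
  by apply: measurable_funS mg; [exact: measurable_box|move=> x []].
Qed.

End finite_families.

Lemma cube_continuous_comp (R : realType) n (f : 'rV[R]_n -> R)
    (psi : 'rV[R]_n -> 'rV[R]_n) :
  (forall s, cube s -> cube (psi s)) ->
  (forall s t i, `|psi s 0 i - psi t 0 i| <= `|s 0 i - t 0 i|) ->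
  cube_continuous f -> cube_continuous (f \o psi).
Proof.
move=> cpsi npsi /cube_continuousP cf; apply/cube_continuousP => t ct e e0.
have [d d0 fd] := cf _ (cpsi t ct) e e0; exists d => // s cs st.
by apply: fd; [exact: cpsi|move=> i; exact: le_lt_trans (npsi _ _ _) (st i)].
Qed.

Lemma submxrow_colsub (R : Type) k (l : 'I_k -> nat)
    (t : 'rV[R]_(\sum_(j < k) l j)) j :
  submxrow t j = colsub (tagnat.Rank j) t.
Proof. by apply/rowP => i; rewrite !mxE. Qed.

Lemma Rank_inj k (l : 'I_k -> nat) (j : 'I_k) :
  injective (@tagnat.Rank k l j).
Proof.
move=> i i' /(congr1 val)/eqP; rewrite tagnat.eq_Rank => /andP[_ /eqP].
exact: val_inj.
Qed.

(** * Increments of a locally stationary field *)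

Section locally_stationary_field.
Context {R : realType} (k : nat) (l : 'I_k -> nat).
Local Notation d := (\sum_(j < k) l j)%N.
Context (alpha : 'I_k -> R) (disp : measure_display)
  (Omega : measurableType disp) (P : probability Omega R)
  (X : 'rV[R]_d -> {RV P >-> R}) (c : 'I_k -> 'rV[R]_d -> R).
Hypothesis alpha_range : forall j, 0 < alpha j < 2.
Hypothesis X_stationary : locally_stationary alpha c X.

Lemma field_Lfun2 t : cube t -> (X t : Omega -> R) \in Lfun P 2%:E.
Proof.
move=> ct; apply: Lfun2P; first exact: measurable_funP.
by case: X_stationary => -[+ _] _ _ _; exact.
Qed.

Lemma field_increment_continuous y : cube y ->
  cube_continuous (fun t => L2norm P (X t \- X y) ^+ 2).
Proof.
move=> cy; apply: cube_continuousX => t ct.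
apply/cvgrPdist_lt => e e0; rewrite near_withinE.
have [[_ /(_ t ct)/cvgrPdist_lt/(_ e e0)]] := X_stationary.
rewrite near_withinE => ht _ _ _; apply: filterS ht => s + cs => /(_ cs).
rewrite sub0r normrN ger0_norm ?L2norm_ge0//; apply: le_lt_trans.
by rewrite distrC; apply: L2norm_dist; exact: field_Lfun2.
Qed.

(** Local stationarity compares the increment between [x] and [y] with the
    coefficients at [y]; uniform continuity then moves them to a common nearby
    point [t], so that they are the same for all the pairs of a cell. *)
Lemma field_increment_estimate e : 0 < e -> exists2 rho : R, 0 < rho &
  forall t x y, cube t -> cube x -> cube y ->
    (forall m, `|x 0 m - t 0 m| < rho) -> (forall m, `|y 0 m - t 0 m| < rho) ->
    `|L2norm P (X x \- X y) ^+ 2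
      - \sum_j c j t * euclid_norm (submxrow (x - y) j) `^ alpha j| <=
    e * \sum_j euclid_norm (submxrow (x - y) j) `^ alpha j.
Proof.
move=> e0; have [_ hc hX _] := X_stationary.
have cc j : cube_continuous (c j) by apply/cube_continuousE; case: (hc j).
have c0 j t : cube t -> 0 < c j t by case: (hc j) => _; exact.
have /choice[M hM] : forall j, exists M, forall t, cube t -> c j t <= M.
  by move=> j; have [t _ ht] := cube_continuous_max (cc j); exists (c j t).
pose C := \sum_j `|M j|.
have C0 : 0 <= C by apply: sumr_ge0.
have cC j t : cube t -> c j t <= C.
  move=> ct; apply: le_trans (hM j t ct) _; apply: le_trans (ler_norm _) _.
  by rewrite /C (bigD1 j)//= lerDl sumr_ge0.
(* [eps * C] bounds the error of local stationarity and [eps] that of moving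
   the coefficients; [eps <= 1] excludes a zero denominator below *)
pose eps := Num.min 1 (e / (C + 1)).
have C10 : 0 < C + 1 by rewrite ltr_wpDl.
have eps0 : 0 < eps by rewrite lt_min ltr01 divr_gt0.
have eps1 : eps <= 1 by rewrite ge_min lexx.
have epsC : eps * (C + 1) <= e.
  by rewrite -ler_pdivlMr// ge_min lexx orbT.
have [delta delta0 hdelta] := hX _ eps0.
have [rho1 rho10 hrho1] : exists2 rho : R, 0 < rho & forall j, forall s t,
    cube s -> cube t -> (forall m, `|s 0 m - t 0 m| < rho) ->
    `|c j s - c j t| < eps.
  apply: fin_common_bound => [j|j r r' r'0 r'r h s t cs ct st].
    by have [r r0 hr] := cube_unif_continuous (cc j) eps0; exists r.
  by apply: h => // m; exact: lt_le_trans (st m) r'r.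
have D1 : 0 < Num.sqrt d%:R + 1 :> R by rewrite ltr_wpDl ?sqrtr_ge0.
have D0 : 0 < 2 * (Num.sqrt d%:R + 1) :> R.
  by rewrite mulr_gt0.
exists (Num.min rho1 (delta / (2 * (Num.sqrt d%:R + 1)))).
  by rewrite lt_min rho10 divr_gt0.
move=> t x y ct cx cy xt yt.
pose N j := euclid_norm (submxrow (x - y) j) `^ alpha j.
pose G z := \sum_j c j z * N j.
have N0 j : 0 <= N j by exact: powR_ge0.
have cyt j : `|c j y - c j t| <= eps.
  apply/ltW/hrho1 => // m; apply: lt_le_trans (yt m) _.
  by rewrite ge_min lexx.
have GC : G y <= C * \sum_j N j.
  by rewrite mulr_sumr; apply: ler_sum => j _; rewrite ler_wpM2r ?cC.
have Gyt : `|G y - G t| <= eps * \sum_j N j.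
  rewrite -sumrB mulr_sumr; apply: le_trans (ler_norm_sum _ _ _) _.
  by apply: ler_sum => j _; rewrite -mulrBl normrM (ger0_norm (N0 j)) ler_wpM2r.
have Gy0 : 0 <= G y.
  by apply: sumr_ge0 => j _; rewrite mulr_ge0// ltW// c0.
have XG : `|L2norm P (X x \- X y) ^+ 2 - G y| <= eps * G y.
  have [xy|xy] := eqVneq (x - y) 0.
    have -> : G y = 0.
      apply: big1 => j _; rewrite /N xy submxrow0 euclid_norm0 powR0 ?mulr0//.
      by case/andP: (alpha_range j) => /lt0r_neq0.
    have -> : x = y by apply/eqP; rewrite -subr_eq0 xy.
    rewrite L2norm_sqrE; under eq_Rintegral do rewrite /= subrr expr0n.
    by rewrite Rintegral_cst// mul0r subrr normr0 mulr0.
  have xE : y + (x - y) = x by rewrite addrC subrK.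
  have hn : euclid_norm (x - y) < delta.
    apply: le_lt_trans (euclid_norm_le (a := delta / (Num.sqrt d%:R + 1)) _ _) _.
    - by rewrite divr_ge0// ltW.
    - move=> m; rewrite !mxE -(subrK (t 0 m) (x 0 m)) -addrA.
      apply: le_trans (ler_normD _ _) _; rewrite (distrC (t 0 m)).
      have -> : delta / (Num.sqrt d%:R + 1) =
          delta / (2 * (Num.sqrt d%:R + 1)) + delta / (2 * (Num.sqrt d%:R + 1)).
        by field; rewrite gt_eqF.
      apply: lerD.
        by apply/ltW/(lt_le_trans (xt m)); rewrite ge_min lexx orbT.
      by apply/ltW/(lt_le_trans (yt m)); rewrite ge_min lexx orbT.
    - by rewrite mulrCA gtr_pMr// ltr_pdivrMr// mul1r ltrDl.
  have := hdelta y (x - y) cy xy; rewrite xE => /(_ cx hn).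
  rewrite -/(G y) => hq.
  (* otherwise the quotient is 0, at distance 1 from 1 *)
  have Gn0 : G y != 0.
    apply: contraTneq hq => ->; rewrite invr0 mulr0 sub0r normrN1 -leNgt.
    exact: eps1.
  have -> : L2norm P (X x \- X y) ^+ 2 - G y =
      (L2norm P (X x \- X y) ^+ 2 / G y - 1) * G y by field.
  by rewrite normrM (ger0_norm Gy0) ler_wpM2r// ltW.
have -> : L2norm P (X x \- X y) ^+ 2 - G t =
  (L2norm P (X x \- X y) ^+ 2 - G y) + (G y - G t) by ring.
apply: le_trans (ler_normD _ _) _; apply: le_trans (lerD XG Gyt) _.
apply: le_trans (lerD (ler_wpM2l (ltW eps0) GC) (lexx _)) _.
have -> : eps * (C * \sum_j N j) + eps * \sum_j N j = eps * (C + 1) * \sum_j N j.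
  by ring.
by rewrite ler_wpM2r// sumr_ge0.
Qed.

End locally_stationary_field.

(** * The error of the piecewise linear interpolator *)

Section mpli_error.
Context {R : realType} (k : nat) (l : 'I_k -> nat).
Local Notation d := (\sum_(j < k) l j)%N.
Local Notation block := (@tagnat.sig1 k l).
Context (alpha : 'I_k -> R) (disp : measure_display)
  (Omega : measurableType disp) (P : probability Omega R)
  (X : 'rV[R]_d -> {RV P >-> R}) (c : 'I_k -> 'rV[R]_d -> R)
  (h : 'I_k -> R -> R) (B : forall j, fractional_brownian_field (alpha j) (l j)).
Hypothesis l_gt0 : forall j, (0 < l j)%N.
Hypothesis alpha_range : forall j, 0 < alpha j < 2.
Hypothesis X_stationary : locally_stationary alpha c X.
Hypothesis h_density : forall j, design_density (h j).

Let alpha_neq0 j : alpha j != 0.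
Proof. by case/andP: (alpha_range j) => /lt0r_neq0. Qed.

Let c_continuous j : cube_continuous (c j).
Proof. by apply/cube_continuousE; case: X_stationary => _ /(_ j)[]. Qed.

Let c_gt0 j t : cube t -> 0 < c j t.
Proof. by case: X_stationary => _ /(_ j)[_ +] _ _; exact. Qed.

Lemma design_densities_lb : exists2 a : R, 0 < a &
  forall j x, 0 <= x <= 1 -> a <= h j x.
Proof.
apply: fin_common_bound => [j|j a a' _ a'a ha x x01].
  exact: design_density_lb (h_density j).
exact: le_trans a'a (ha x x01).
Qed.

Let blockE (t : 'rV[R]_d) j i : submxrow t j 0 i = t 0 (tagnat.Rank j i).
Proof. by rewrite !mxE. Qed.

Local Notation H j t := (@inv_density R k l h j (submxrow t j)).

Lemma inv_density_itv (a : R) j (t : 'rV[R]_d) : 0 < a ->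
  (forall j x, 0 <= x <= 1 -> a <= h j x) -> cube t ->
  forall i, 0 < H j t 0 i <= a^-1.
Proof.
move=> a0 ha ct i; rewrite mxE blockE.
have hj := ha j _ (ct (tagnat.Rank j i)).
by rewrite invr_gt0 (lt_le_trans a0 hj) lef_pV2// posrE (lt_le_trans a0).
Qed.

Lemma v_integrand_continuous j :
  cube_continuous (fun t => c j t * b_const (B j) (H j t)).
Proof.
apply: cube_continuousM => //; apply/cube_continuousP => t ct e e0.
have [a a0 ha] := design_densities_lb.
have e20 : 0 < e / 2 by rewrite divr_gt0.
have a0' : 0 <= a^-1 by rewrite invr_ge0 ltW.
have [delta delta0 hd] := b_const_modulus (B j) (alpha_range j) a0' e20.
have [r r0 hr] : exists2 r : R, 0 < r & forall i : 'I_(l j),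
    forall s, cube s -> (forall m, `|s 0 m - t 0 m| < r) ->
    `|H j s 0 i - H j t 0 i| < delta.
  apply: fin_common_bound => [i|i r r' _ r'r hr s cs st]; last first.
    by apply: hr => // m; exact: lt_le_trans (st m) r'r.
  have hV : cube_continuous (fun s : 'rV[R]_d => (h j (s 0 (tagnat.Rank j i)))^-1).
    apply: cube_continuousV.
      by apply: cube_continuous_comp_coord; case: (h_density j).
    move=> s cs; rewrite gt_eqF//.
    by case: (h_density j) => _ + _; apply; exact: cs.
  have [r r0 hr] := (cube_continuousP _).1 hV t ct delta delta0.
  by exists r => // s cs st; rewrite ![inv_density _ _ _ _]mxE !blockE; exact: hr.
exists r => // s cs st; apply: le_lt_trans (_ : e / 2 < e); last first.
  by rewrite ltr_pdivrMr// ltr_pMr// ltr1n.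
apply: hd => i.
- by have /andP[/ltW -> ->] := inv_density_itv a0 ha cs i.
- by have /andP[/ltW -> ->] := inv_density_itv a0 ha ct i.
- by apply/ltW/hr.
Qed.

(** The integrand is continuous and positive everywhere, for instance at the
    origin. *)
Lemma v_const_gt0 j : 0 < v_const B c h j.
Proof.
have [a a0 ha] := design_densities_lb.
apply: (@cube_integral_gt0 _ _ _ 0).
- exact: v_integrand_continuous.
- by move=> t ct; rewrite mulr_ge0 ?b_const_ge0// ltW// c_gt0.
- exact: cube0.
- rewrite mulr_gt0 ?c_gt0//; first exact: cube0.
  apply: b_const_gt0 => // i.
  by have /andP[] := inv_density_itv a0 ha (@cube0 R d) i.
Qed.

Section one_grid.
Context (n : 'I_k -> nat) (knot : 'I_d -> nat -> R)
  (XN : 'rV[R]_d -> Omega -> R).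
Hypothesis n_gt0 : forall j, (0 < n j)%N.
Hypothesis knot_regular : cross_regular h n knot.
Hypothesis XN_mpli : is_mpli n knot X XN.

Let knotP m i : (i <= n (block m))%N -> 0 <= knot m i <= 1 /\
  \int[lebesgue_measure]_(v in `[0, knot m i]) h (block m) v =
    i%:R / (n (block m))%:R.
Proof. exact: knot_regular. Qed.

Definition cell (i : 'I_d -> nat) (s : 'rV[R]_d) : 'rV[R]_d :=
  \row_m (knot m (i m) + (knot m (i m).+1 - knot m (i m)) * s 0 m).

Let proper (i : 'I_d -> nat) := forall m, (i m < n (block m))%N.

Let knot_step_gt0 m i : (i < n (block m))%N -> 0 < knot m i.+1 - knot m i.
Proof.
move=> im; rewrite subr_gt0.
exact: (knot_lt (h_density _) (n_gt0 _) (@knotP m)).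
Qed.

Let cell_cube i s : proper i -> cube s -> cube (cell i s).
Proof.
move=> pi cs m; rewrite mxE; have /andP[s0 s1] := cs m.
have [/andP[t0 _] _] := knotP (ltnW (pi m)).
have [/andP[_ u1] _] := knotP (pi m).
have r0 := ltW (knot_step_gt0 (pi m)).
rewrite addr_ge0 ?mulr_ge0//=; apply: le_trans u1.
by rewrite -lerBrDl ler_piMr.
Qed.

Let cellE i s : cell i s =
  grid_point knot i +
  cmul (grid_point knot (fun m => (i m).+1) - grid_point knot i) s.
Proof. by apply/rowP => m; rewrite !mxE. Qed.

Lemma mpli_cell_error i s : proper i -> cube s ->
  L2norm P (X (cell i s) \- XN (cell i s)) ^+ 2 =
  interp_error (fun x y => L2norm P (X (cell i x) \- X (cell i y)) ^+ 2) s.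
Proof.
move=> pi cs.
rewrite -(@L2norm_interpolation _ _ _ P _ (fun x => X (cell i x)))//; last first.
  by move=> x cx; apply: (field_Lfun2 X_stationary); exact: cell_cube.
congr (L2norm P _ ^+ 2); apply/funext => w /=; congr (_ - _).
rewrite [in LHS]cellE XN_mpli//; apply: eq_bernoulli_mean => x _.
by rewrite cellE.
Qed.

Lemma mpli_cell_error_continuous i : proper i -> cube_continuous
  (interp_error (fun x y => L2norm P (X (cell i x) \- X (cell i y)) ^+ 2)).
Proof.
move=> pi; apply: cube_continuous_interp => y cy.
apply: (@cube_continuous_comp _ _ (fun t => L2norm P (X t \- X (cell i y)) ^+ 2)).
- by move=> s; exact: cell_cube.
- move=> s t m; rewrite !mxE opprD addrACA subrr add0r -mulrBr normrM.
  have [/andP[t0 _] _] := knotP (ltnW (pi m)).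
  have [/andP[_ u1] _] := knotP (pi m).
  have r0 := knot_step_gt0 (pi m).
  rewrite ler_piMl// gtr0_norm//; lra.
- by apply: (field_increment_continuous X_stationary); exact: cell_cube.
Qed.

(** On each cell the error is a continuous function of the local coordinates. *)
Lemma mpli_error_integrand :
  cube_integrand (fun t => L2norm P (X t \- XN t) ^+ 2).
Proof.
pose M := (\max_j n j)%N.
pose I := {i : {ffun 'I_d -> 'I_M} | [forall m, i m < n (block m)]%N}.
have pI (i : I) : proper (fun m => val i m) by move=> m; exact: (forallP (valP i)).
apply: (@cube_integrand_cells _ _ I (fun i => grid_point knot (fun m => val i m))
  (fun i => grid_point knot (fun m => (val i m).+1)
            - grid_point knot (fun m => val i m)) _
  (fun i => interp_error (fun x y =>
     L2norm P (X (cell (fun m => val i m) x) \-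
                X (cell (fun m => val i m) y)) ^+ 2))).
- by move=> i m; rewrite !mxE knot_step_gt0//; exact: (pI i).
- move=> t ct.
  have /choice[f hf] : forall m, exists i, (i < n (block m))%N /\
      knot m i <= t 0 m <= knot m i.+1.
    move=> m.
    have [i im ti] := knot_cover (h_density _) (n_gt0 _) (@knotP m) (ct m).
    by exists i.
  have fM m : (f m < M)%N by apply: leq_trans (hf m).1 (leq_bigmax _).
  pose i0 : {ffun 'I_d -> 'I_M} := [ffun m => Ordinal (fM m)].
  have i0P : [forall m, i0 m < n (block m)]%N.
    by apply/forallP => m; rewrite ffunE; exact: (hf m).1.
  exists (exist _ i0 i0P); pose r m := knot m (f m).+1 - knot m (f m).
  have r0 m : 0 < r m by apply: knot_step_gt0; exact: (hf m).1.
  exists (\row_m ((t 0 m - knot m (f m)) / r m)).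
    move=> m; rewrite mxE; have [_ /andP[h1 h2]] := hf m.
    apply/andP; split; last by rewrite ler_pdivrMr// mul1r lerB.
    by apply: divr_ge0; [rewrite subr_ge0|exact: ltW].
  apply/rowP => m; rewrite !mxE !ffunE/= -/(r m) mulrC divfK ?gt_eqF//.
  by rewrite addrC subrK.
- by move=> i s cs; rewrite -cellE mpli_cell_error//; exact: pI.
- move=> i; apply: cube_continuous_integrand.
  by apply: mpli_cell_error_continuous; exact: pI.
Qed.

End one_grid.
Let block_diff (r : 'rV[R]_d) j x y :
  submxrow (cmul r (x - y)) j =
  cmul (submxrow r j) (submxrow x j - submxrow y j).
Proof. by apply/rowP => i; rewrite !mxE. Qed.

Let powR_inv (x p : R) : 0 < x -> x^-1 `^ p = (x `^ p)^-1.
Proof. by move=> x0; rewrite -powR_inv1 ?ltW// -powRrM mulN1r powRN. Qed.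

(** On a small cell the increments of the field are close in mean square to
    those of a sum of independent fractional Brownian fields, one for each
    block, and the steps of the grid are close to [1 / n j] times the inverse
    densities.  The bound is relative to the size [n j ^ - alpha j] of the main
    terms. *)
Lemma cell_estimate a e : 0 < a -> (forall j x, 0 <= x <= 1 -> a <= h j x) ->
  0 < e -> exists2 rho : R, 0 < rho &
  forall (n : 'I_k -> nat) (knot : 'I_d -> nat -> R) (i : 'I_d -> nat),
    (forall j, (0 < n j)%N) -> cross_regular h n knot ->
    (forall j, (n j)%:R^-1 * a^-1 < rho) ->
    (forall m, (i m < n (block m))%N) -> forall s, cube s ->
    `|interp_error (fun x y =>
        L2norm P (X (cell knot i x) \- X (cell knot i y)) ^+ 2) s
      - \sum_j ((n j)%:R `^ alpha j)^-1 * (c j (cell knot i 0) *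
          fbf_interp_error (alpha j) (H j (cell knot i 0)) (submxrow s j))| <=
    e * \sum_j ((n j)%:R `^ alpha j)^-1.
Proof.
move=> a0 ha e0; have a0' : 0 < a^-1 by rewrite invr_gt0.
pose K j := (Num.sqrt (l j)%:R * a^-1) `^ alpha j.
have K0 j : 0 <= K j by exact: powR_ge0.
pose KK := \sum_j K j; have KK0 : 0 <= KK by apply: sumr_ge0.
have KK10 : 0 < KK + 1 by rewrite ltr_wpDl.
have e10 : 0 < e / (3 * (KK + 1)) by rewrite divr_gt0// mulr_gt0.
(* [3 / 2 * e1 * KK] and [C * e2] are both at most [e / 2]: these are the costs of
   freezing the increments and of replacing the steps *)
set e1 := e / (3 * (KK + 1)) in e10.
have [rho1 rho10 hrho1] := field_increment_estimate alpha_range X_stationary e10.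
have /choice[M hM] : forall j, exists M, forall t, cube t -> c j t <= M.
  move=> j; have [t _ ht] := cube_continuous_max (@c_continuous j).
  by exists (c j t).
pose C := \sum_j `|M j|; have C0 : 0 <= C by apply: sumr_ge0.
have cC j t : cube t -> c j t <= C.
  move=> ct; apply: le_trans (hM j t ct) _; apply: le_trans (ler_norm _) _.
  by rewrite /C (bigD1 j)//= lerDl sumr_ge0.
have C10 : 0 < C + 1 by rewrite ltr_wpDl.
have e20 : 0 < e / (2 * (C + 1)) by rewrite divr_gt0// mulr_gt0.
set e2 := e / (2 * (C + 1)) in e20.
have [delta delta0 hdelta] : exists2 delta : R, 0 < delta &
    forall j (u u' : 'rV[R]_(l j)),
    (forall i, `|u 0 i| <= a^-1) -> (forall i, `|u' 0 i| <= a^-1) ->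
    (forall i, `|u 0 i - u' 0 i| <= delta) -> forall s, cube s ->
    `|fbf_interp_error (alpha j) u s - fbf_interp_error (alpha j) u' s| <= e2.
  apply: fin_common_bound => [j|j r r' _ r'r hr u u' uK u'K uu' s cs]; last first.
    by apply: hr => // i; exact: le_trans (uu' i) r'r.
  exact: (@fbf_interp_error_modulus R (alpha j) (l j) (alpha_range j) a^-1 e2
            (ltW a0') e20).
have da0 : 0 < delta * a ^+ 2 by rewrite mulr_gt0// exprn_gt0.
have [rho2 rho20 hrho2] : exists2 rho : R, 0 < rho & forall j x y,
    0 <= x <= 1 -> 0 <= y <= 1 -> `|x - y| < rho ->
    `|h j x - h j y| < delta * a ^+ 2.
  apply: fin_common_bound => [j|j r r' _ r'r hr x y x01 y01 xy].
    exact: design_density_unif (h_density j) _ da0.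
  by apply: hr => //; exact: lt_le_trans xy r'r.
exists (Num.min rho1 rho2); first by rewrite lt_min rho10.
move=> n knot i n_gt0 knot_reg mesh pi s cs.
have nR0 j : 0 < (n j)%:R :> R by rewrite ltr0n.
have knotP m p : (p <= n (block m))%N -> 0 <= knot m p <= 1 /\
    \int[lebesgue_measure]_(v in `[0, knot m p]) h (block m) v =
    p%:R / (n (block m))%:R by exact: knot_reg.
pose r : 'rV[R]_d := \row_m (knot m (i m).+1 - knot m (i m)).
have r0 m : 0 < r 0 m.
  by rewrite mxE subr_gt0; exact: (knot_lt (h_density _) (n_gt0 _) (@knotP m)).
have nr m : (n (block m))%:R * r 0 m <= a^-1.
  rewrite mxE.
  exact: (knot_step_le (h_density _) (n_gt0 _) (@knotP m) a0 (@ha _) (pi m)).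
have rmesh m : r 0 m <= (n (block m))%:R^-1 * a^-1.
  by rewrite ler_pdivlMl.
have rrho m : r 0 m < Num.min rho1 rho2 by exact: le_lt_trans (mesh _).
pose t0 := cell knot i 0.
have t0E m : t0 0 m = knot m (i m) by rewrite !mxE mulr0 addr0.
have ccell x : cube x -> cube (cell knot i x).
  move=> cx m; rewrite mxE; have /andP[x0 x1] := cx m.
  have [/andP[p0 _] _] := knotP _ _ (ltnW (pi m)).
  have [/andP[_ q1] _] := knotP _ _ (pi m).
  have rm := ltW (r0 m); rewrite mxE in rm.
  rewrite addr_ge0 ?mulr_ge0//=; apply: le_trans q1.
  by rewrite -lerBrDl ler_piMr.
have ct0 : cube t0 by apply: ccell; exact: cube0.
have cellB x y : cell knot i x - cell knot i y = cmul r (x - y).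
  by apply/rowP => m; rewrite !mxE; ring.
have cell_near x m : cube x -> `|cell knot i x 0 m - t0 0 m| < rho1.
  move=> cx; rewrite t0E mxE addrAC subrr add0r; have /andP[x0 x1] := cx m.
  have := rrho m; rewrite lt_min => /andP[+ _]; apply: le_lt_trans.
  rewrite mxE normrM (ger0_norm x0) -[leRHS]mulr1; have := r0 m.
  by rewrite mxE => rm; rewrite gtr0_norm// ler_wpM2l// ltW.
pose A j := ((n j)%:R `^ alpha j)^-1.
have A0 j : 0 <= A j by rewrite invr_ge0 powR_ge0.
have blockr j (x y : 'rV[R]_d) : cube x -> cube y ->
    euclid_norm (submxrow (cmul r (x - y)) j) `^ alpha j <= A j * K j.
  move=> cx cy.
  have nj0 : 0 <= (n j)%:R^-1 :> R by rewrite invr_ge0 ltW.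
  have aj0 := ltW a0'; have sj0 := sqrtr_ge0 ((l j)%:R : R).
  rewrite /A -powR_inv// /K -powRM//; last by rewrite mulr_ge0.
  apply: ge0_ler_powR; rewrite ?nnegrE ?euclid_norm_ge0//.
  - by case/andP: (alpha_range j) => /ltW.
  - by rewrite !mulr_ge0.
  rewrite mulrCA; apply: euclid_norm_le => [|p]; first by rewrite mulr_ge0.
  rewrite blockE [cmul r _ 0 _]mxE normrM (gtr0_norm (r0 _)).
  rewrite -[leRHS]mulr1; apply: ler_pM => //; first exact: ltW.
    by have := rmesh (tagnat.Rank j p); rewrite tagnat.Rank1K.
  by rewrite !mxE; exact: cube_coord_dist.
set S := \sum_j A j; have S0 : 0 <= S by apply: sumr_ge0.
pose G (x y : 'rV[R]_d) := \sum_j c j t0 *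
  euclid_norm (cmul (submxrow r j) (submxrow x j - submxrow y j)) `^ alpha j.
have step1 : `|interp_error (fun x y =>
      L2norm P (X (cell knot i x) \- X (cell knot i y)) ^+ 2) s
    - interp_error G s| <= 3 / 2 * (e1 * (KK * S)).
  apply: interp_error_dist => // x y cx cy.
  have := hrho1 t0 _ _ ct0 (ccell x cx) (ccell y cy)
    (fun m => cell_near x m cx) (fun m => cell_near y m cy).
  rewrite cellB (eq_bigr (fun j => c j t0 * euclid_norm (cmul (submxrow r j)
      (submxrow x j - submxrow y j)) `^ alpha j)); last first.
    by move=> j _; rewrite block_diff.
  move=> h1; apply: le_trans h1 _; apply: ler_wpM2l; first exact: ltW.
  apply: le_trans (_ : \sum_j (A j * K j) <= _).
    by apply: ler_sum => j _; exact: blockr.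
  rewrite /KK mulr_suml; apply: ler_sum => j _; rewrite mulrC ler_wpM2l//.
  by rewrite /S (bigD1 j)//= lerDl sumr_ge0.
have GE : interp_error G s =
    \sum_j A j * (c j t0 * fbf_interp_error (alpha j)
      ((n j)%:R *: submxrow r j) (submxrow s j)).
  rewrite interp_error_sum; apply: eq_bigr => j _; rewrite interp_errorZ.
  rewrite mulrCA; congr (_ * _).
  rewrite /fbf_interp_error [submxrow s j]submxrow_colsub -interp_error_colsub;
    last exact: Rank_inj.
  have nj0 : 0 <= (n j)%:R^-1 :> R by rewrite invr_ge0 ltW.
  rewrite /A -powR_inv// -interp_errorZ; congr interp_error.
  apply/funext => x; apply/funext => y; rewrite -!submxrow_colsub.
  rewrite -(@powRM _ _ _ (alpha j) nj0 (euclid_norm_ge0 _)) -(euclid_normZ _ nj0).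
  congr (euclid_norm _ `^ _); apply/rowP => p.
  by rewrite !mxE !mulrA mulVf ?mul1r// gt_eqF.
have step2 : `|interp_error G s - \sum_j A j * (c j t0 *
    fbf_interp_error (alpha j) (H j t0) (submxrow s j))| <= C * e2 * S.
  rewrite GE -sumrB mulr_sumr; apply: le_trans (ler_norm_sum _ _ _) _.
  apply: ler_sum => j _; rewrite -mulrBr normrM (ger0_norm (A0 j)) mulrC.
  apply: ler_wpM2r => //; rewrite -mulrBr normrM gtr0_norm; last exact: c_gt0.
  apply: ler_pM => //; [exact/ltW/c_gt0|exact: cC|].
  have blk p : block (tagnat.Rank j p) = j by rewrite tagnat.Rank1K.
  apply: hdelta => [p|p|p|p].
  - rewrite mxE blockE ger0_norm; last by rewrite mulr_ge0// ltW.
    by have := nr (tagnat.Rank j p); rewrite blk.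
  - have /andP[h1 h2] := inv_density_itv a0 ha ct0 p.
    by rewrite gtr0_norm.
  - rewrite [X in X - _]mxE [X in _ - X]mxE !blockE t0E [r 0 _]mxE.
    have := knot_step_dist (h_density _) (n_gt0 _) (@knotP (tagnat.Rank j p)) a0
      (@ha _) (@hrho2 _) (pi _).
    rewrite !blk; apply; have := rrho (tagnat.Rank j p).
    by rewrite mxE lt_min => /andP[].
  - by rewrite blockE; exact: cs.
rewrite -(subrK (interp_error G s) (interp_error _ s)) -addrA.
apply: le_trans (ler_normD _ _) _; apply: le_trans (lerD step1 step2) _.
have -> : 3 / 2 * (e1 * (KK * S)) + C * e2 * S = (3 / 2 * e1 * KK + C * e2) * S.
  by ring.
apply: ler_wpM2r => //.
have e2' : 0 <= e / 2 by rewrite divr_ge0// ltW.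
have h1 : 3 / 2 * e1 * KK <= e / 2.
  have -> : 3 / 2 * e1 * KK = e / 2 * (KK / (KK + 1)).
    by rewrite /e1; field; rewrite gt_eqF.
  by apply: ler_piMr => //; rewrite ler_pdivrMr// mul1r lerDl.
have h2 : C * e2 <= e / 2.
  have -> : C * e2 = e / 2 * (C / (C + 1)) by rewrite /e2; field; rewrite gt_eqF.
  by apply: ler_piMr => //; rewrite ler_pdivrMr// mul1r lerDl.
lra.
Qed.
(** Both the error and the integrand of [v_j] are compared, cell by cell, with
    their values frozen at the corner of the cell: the first by
    [cell_estimate], the second by uniform continuity. *)
Lemma mpli_error_estimate a e : 0 < a ->
  (forall j x, 0 <= x <= 1 -> a <= h j x) -> 0 < e ->
  exists2 rho : R, 0 < rho &
  forall (n : 'I_k -> nat) (knot : 'I_d -> nat -> R) (XN : 'rV[R]_d -> Omega -> R),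
    (forall j, (0 < n j)%N) -> cross_regular h n knot -> is_mpli n knot X XN ->
    (forall j, (n j)%:R^-1 * a^-1 < rho) ->
    `|cube_integral (fun t => L2norm P (X t \- XN t) ^+ 2)
      - \sum_j v_const B c h j / (n j)%:R `^ alpha j| <=
    e * \sum_j ((n j)%:R `^ alpha j)^-1.
Proof.
move=> a0 ha e0; have e20 : 0 < e / 2 by rewrite divr_gt0.
have [rho1 rho10 hrho1] := cell_estimate a0 ha e20.
pose phi j (t : 'rV[R]_d) := c j t * b_const (B j) (H j t).
have cphi j : cube_continuous (phi j) by exact: v_integrand_continuous.
have phi_ge0 j t : cube t -> 0 <= phi j t.
  by move=> ct; rewrite mulr_ge0 ?b_const_ge0// ltW// c_gt0.
have [rho2 rho20 hrho2] : exists2 rho : R, 0 < rho & forall j s t,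
    cube s -> cube t -> (forall m, `|s 0 m - t 0 m| < rho) ->
    `|phi j s - phi j t| < e / 2.
  apply: fin_common_bound => [j|j r r' _ r'r hr s t cs ct st].
    exact: cube_unif_continuous.
  by apply: hr => // m; exact: lt_le_trans (st m) r'r.
exists (Num.min rho1 rho2); first by rewrite lt_min rho10.
move=> n knot XN n_gt0 knot_reg XNP mesh.
have knotP m p : (p <= n (block m))%N -> 0 <= knot m p <= 1 /\
    \int[lebesgue_measure]_(v in `[0, knot m p]) h (block m) v =
    p%:R / (n (block m))%:R by exact: knot_reg.
pose M := (\max_j n j)%N.
(* beyond its last knot each coordinate is padded with cells of width 0, so
   that all the coordinates have the same number of cells *)
pose t m i := knot m (minn i (n (block m))).
have nM m : (n (block m) <= M)%N by exact: leq_bigmax.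
have t0 m : t m 0%N = 0.
  by rewrite /t min0n; exact: (knot0 (h_density _) (@knotP m)).
have tM m : t m M = 1.
  rewrite /t (minn_idPr (nM m)).
  exact: (knotn (h_density _) (n_gt0 _) (@knotP m)).
have tlt m i : (i < n (block m))%N -> t m i < t m i.+1.
  move=> im; rewrite /t (minn_idPl (ltnW im)) (minn_idPl im).
  exact: (knot_lt (h_density _) (n_gt0 _) (@knotP m)).
have tpad m i : (n (block m) <= i)%N -> t m i.+1 - t m i = 0.
  by move=> im; rewrite /t !(minn_idPr _) ?subrr// ltnW.
have tS m i : (i < M)%N -> t m i <= t m i.+1.
  move=> _; have [/tlt/ltW//|/tpad/eqP] := ltnP i (n (block m)).
  by rewrite subr_eq0 => /eqP ->.
pose f u := L2norm P (X u \- XN u) ^+ 2.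
have hf : cube_integrand f by exact: mpli_error_integrand knot_reg XNP.
have f0 u : cube u -> 0 <= f u by move=> _; exact: sqr_ge0.
have hphi j : cube_integrand (phi j) by exact: cube_continuous_integrand.
pose cl (i : {ffun 'I_d -> 'I_M}) (s : 'rV[R]_d) : 'rV[R]_d :=
  \row_m (t m (i m) + (t m (i m).+1 - t m (i m)) * s 0 m).
pose w (i : {ffun 'I_d -> 'I_M}) := \prod_m (t m (i m).+1 - t m (i m)).
have subdiv u : cube_integrand u -> (forall x, cube x -> 0 <= u x) ->
    (forall i, cube_map (cl i)) /\
    cube_integral u = \sum_i w i * cube_integral (u \o cl i).
  exact: (cube_integral_subdivision t0 tM tS).
have [hcell fE] := subdiv f hf f0.
have phiE j := (subdiv (phi j) (hphi j) (phi_ge0 j)).2.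
have [_ oneE] := subdiv (fun=> 1) (cube_integrand_cst _ 1) (fun _ _ => ler01).
have w0 i : 0 <= w i.
  by apply: prodr_ge0 => m _; rewrite subr_ge0 tS.
have w1 : \sum_i w i = 1.
  rewrite -[RHS](@cube_integral_cst R d) oneE; apply: eq_bigr => i _.
  by rewrite (@cube_integral_cst R d) mulr1.
pose A j := ((n j)%:R `^ alpha j)^-1.
have A0 j : 0 <= A j by rewrite invr_ge0 powR_ge0.
set S := \sum_j A j; have S0 : 0 <= S by apply: sumr_ge0.
have vE : \sum_j v_const B c h j / (n j)%:R `^ alpha j =
    \sum_i w i * \sum_j A j * cube_integral (phi j \o cl i).
  transitivity (\sum_j \sum_i w i * (A j * cube_integral (phi j \o cl i))).
    apply: eq_bigr => j _; rewrite mulrC -/(A j) [v_const _ _ _ _]phiE mulr_sumr.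
    by apply: eq_bigr => i _; rewrite mulrCA.
  by rewrite exchange_big; apply: eq_bigr => i _; rewrite mulr_sumr.
rewrite vE -/f fE -sumrB; apply: le_trans (ler_norm_sum _ _ _) _.
rewrite -[leRHS]mul1r -w1 mulr_suml; apply: ler_sum => i _.
rewrite -mulrBr normrM (ger0_norm (w0 i)).
have [pi|/forallPn[m]] := boolP [forall m, i m < n (block m)]%N; last first.
  rewrite -leqNgt => /tpad tm.
  suff -> : w i = 0 by rewrite !mul0r.
  by rewrite /w (bigD1 m)//= tm mul0r.
have {}pi m : (i m < n (block m))%N by exact: (forallP pi).
apply: ler_wpM2l => //.
have clE s : cl i s = cell knot (fun m => i m) s.
  apply/rowP => m; rewrite !mxE /t (minn_idPl (ltnW (pi m))).
  by rewrite (minn_idPl (pi m)).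
pose u0 := cell knot (fun m => i m) 0.
have cu0 : cube u0 by rewrite /u0 -clE; apply: (hcell i).2; exact: cube0.
have hA : `|cube_integral (f \o cl i) - \sum_j A j * phi j u0| <= e / 2 * S.
  pose g (s : 'rV[R]_d) := \sum_j A j * (c j u0 *
    fbf_interp_error (alpha j) (H j u0) (submxrow s j)).
  have hQ j : cube_integrand (fbf_interp_error (alpha j) (H j u0)).
    by apply: cube_continuous_integrand; exact: fbf_interp_error_continuous.
  have hQ' j : cube_integrand (fun s : 'rV[R]_d =>
      fbf_interp_error (alpha j) (H j u0) (submxrow s j)).
    apply: eq_cube_integrand
      (cube_integrand_comp (cube_map_colsub (tagnat.Rank j)) (hQ j)).
    by move=> s _; rewrite /= submxrow_colsub.
  have H0 j : orthant (H j u0).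
    by move=> p; have /andP[/ltW] := inv_density_itv a0 ha cu0 p.
  have -> : \sum_j A j * phi j u0 = cube_integral g.
    rewrite cube_integral_sum; last first.
      by move=> j; apply: cube_integrandZ; exact: cube_integrandZ.
    apply: eq_bigr => j _; rewrite cube_integralZ; last exact: cube_integrandZ.
    rewrite cube_integralZ//; congr (_ * (_ * _)).
    rewrite b_constE// -(cube_integral_colsub (@Rank_inj k l j) (hQ j)).
      by apply: eq_cube_integral => s _; rewrite submxrow_colsub.
    by move=> s cs; exact: fbf_interp_error_ge0.
  apply: cube_integral_dist.
  - exact: cube_integrand_comp.
  - apply: cube_integrand_sum => j.
    by apply: cube_integrandZ; exact: cube_integrandZ.
  - move=> s cs; rewrite /= clE /f (mpli_cell_error n_gt0 knot_reg XNP)//.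
    apply: hrho1 => // j; apply: lt_le_trans (mesh j) _.
    by rewrite ge_min lexx.
have hB : `|\sum_j A j * phi j u0 - \sum_j A j * cube_integral (phi j \o cl i)|
    <= e / 2 * S.
  rewrite -sumrB mulr_sumr; apply: le_trans (ler_norm_sum _ _ _) _.
  apply: ler_sum => j _; rewrite -mulrBr normrM (ger0_norm (A0 j)) mulrC.
  apply: ler_wpM2r => //; rewrite distrC -[X in _ - X](@cube_integral_cst R d).
  apply: cube_integral_dist.
  - exact: cube_integrand_comp.
  - exact: cube_integrand_cst.
  move=> s cs; apply/ltW/hrho2 => //; first exact: (hcell i).2.
  move=> m; rewrite clE !mxE mulr0 addr0 addrAC subrr add0r.
  have /andP[s0 s1] := cs m; rewrite normrM (ger0_norm s0).
  have := tlt m _ (pi m); rewrite /t (minn_idPl (ltnW (pi m))) (minn_idPl (pi m)).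
  rewrite -subr_gt0 => r0; rewrite gtr0_norm//.
  apply: le_lt_trans (_ : (n (block m))%:R^-1 * a^-1 < _); last first.
    by apply: lt_le_trans (mesh _) _; rewrite ge_min lexx orbT.
  apply: le_trans (_ : knot m (i m).+1 - knot m (i m) <= _).
    by rewrite ler_piMr// ltW.
  rewrite ler_pdivlMl ?ltr0n//.
  exact: (knot_step_le (h_density _) (n_gt0 _) (@knotP m) a0 (@ha _) (pi m)).
rewrite -(subrK (\sum_j A j * phi j u0) (cube_integral _)) -addrA.
apply: le_trans (ler_normD _ _) _; apply: le_trans (lerD hA hB) _.
by rewrite -mulrDl -splitr.
Qed.

End mpli_error.

Theorem theorem1 (R : realType) (k : nat) (l : 'I_k -> nat) (alpha : 'I_k -> R)
    (disp : measure_display) (Omega : measurableType disp)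
    (P : probability Omega R)
    (X : 'rV[R]_(\sum_(j < k) l j) -> {RV P >-> R})
    (c : 'I_k -> 'rV[R]_(\sum_(j < k) l j) -> R)
    (h : 'I_k -> R -> R)
    (NN : set nat) (n : nat -> 'I_k -> nat)
    (knot : nat -> 'I_(\sum_(j < k) l j) -> nat -> R)
    (XN : nat -> 'rV[R]_(\sum_(j < k) l j) -> Omega -> R)
    (B : forall j : 'I_k, fractional_brownian_field (alpha j) (l j))
    (k_gt0 : (0 < k)%N)
    (l_gt0 : forall j, (0 < l j)%N)
    (alpha_range : forall j, 0 < alpha j < 2)
    (X_stationary : locally_stationary alpha c X)
    (h_density : forall j, design_density (h j))
    (n_sizes : design_sizes l NN n)
    (knot_regular : forall N, NN N -> cross_regular h (n N) (knot N))
    (XN_mpli : forall N, NN N -> is_mpli (n N) (knot N) X (XN N)) :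
  let v := v_const B c h in
  let rate N := \sum_j v j / (n N j)%:R `^ alpha j in
  [/\ forall j, 0 < v j,
      forall N, NN N -> 0 < rate N
    & (fun N => field_norm P (fun t => X t \- XN N t) ^+ 2 / rate N)
        @ within NN \oo --> (1 : R)].
Proof.
move=> v rate; have [_ n_gt0 _ n_oo] := n_sizes.
have v0 j : 0 < v j.
  exact: (v_const_gt0 B l_gt0 alpha_range X_stationary h_density).
pose S N : R := \sum_j ((n N j)%:R `^ alpha j)^-1.
have term0 N j : NN N -> 0 < ((n N j)%:R `^ alpha j)^-1 :> R.
  by move=> NNN; rewrite invr_gt0 powR_gt0// ltr0n n_gt0.
(* [w] compares the error bound, in terms of [S], with the rate *)
have [w w0 wv] : exists2 w : R, 0 < w & forall j, w <= v j.
  apply: fin_common_bound => [j|j r r' _]; first by exists (v j).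
  exact: le_trans.
have rateS N : NN N -> w * S N <= rate N.
  move=> NNN; rewrite mulr_sumr; apply: ler_sum => j _.
  by rewrite ler_wpM2r// ltW// term0.
have S0 N : NN N -> 0 < S N.
  move=> NNN; rewrite /S (bigD1 (Ordinal k_gt0))//=; apply: ltr_wpDr.
    by apply: sumr_ge0 => j _; rewrite ltW// term0.
  exact: term0.
have rate0 N : NN N -> 0 < rate N.
  by move=> NNN; apply: lt_le_trans (rateS N NNN); rewrite mulr_gt0// S0.
split=> //; apply/cvgrPdist_le => e e0.
have [a a0 ha] := design_densities_lb h_density.
have ew0 : 0 < e * w by rewrite mulr_gt0.
have [rho rho0 hrho] := @mpli_error_estimate R k l alpha disp Omega P X c h B
  alpha_range X_stationary h_density a (e * w) a0 ha ew0.
have mesh j : \forall N \near within NN \oo, (n N j)%:R^-1 * a^-1 < rho.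
  have : \forall p \near \oo, (p%:R^-1 * a^-1 : R) < rho.
    near=> p; have p0 : 0 < p%:R :> R by near: p; exact: nbhs_infty_gtr.
    rewrite -invfM invf_plt ?posrE ?mulr_gt0// -ltr_pdivrMr//.
    by near: p; exact: nbhs_infty_gtr.
  exact: n_oo.
have {}mesh : \forall N \near within NN \oo, forall j, (n N j)%:R^-1 * a^-1 < rho.
  exact: filter_forall.
have NNnear : \forall N \near within NN \oo, NN N by exact: withinT.
near=> N; have NNN : NN N by near: N.
have meshN : forall j, (n N j)%:R^-1 * a^-1 < rho by near: N.
have := hrho _ _ _ (n_gt0 N NNN) (knot_regular N NNN) (XN_mpli N NNN) meshN.
rewrite -/(S N) -/v -/(rate N) => hN.
rewrite /field_norm sqr_sqrtr; last first.
  by apply: cube_integral_ge0 => t _; exact: sqr_ge0.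
set E := cube_integral _ in hN *.
have -> : 1 - E / rate N = (rate N - E) / rate N.
  by rewrite mulrBl divff// gt_eqF// rate0.
rewrite normrM normfV (gtr0_norm (rate0 N NNN)) ler_pdivrMr ?rate0// distrC.
apply: le_trans hN _; rewrite -mulrA ler_wpM2l ?rateS//; exact: ltW.
Unshelve. all: end_near. Qed.
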